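(* Let $q\ge2$, let $\{N_k\}_{k\ge1}$ be i.i.d. standard normal random variables, let $\alpha_{\infty,1},\dots,\alpha_{\infty,q}$ be non-zero, pairwise distinct real numbers, and let $F_\infty=\sum_{k=1}^q\alpha_{\infty,k}(N_k^2-1)$ with $\mathbb{E}[F_\infty^2]=1$. For each $n\ge1$ let $F_n=\sum_{k\ge1}\alpha_{n,k}(N_k^2-1)$, with $\alpha_{n,k}\in\mathbb{R}$, be an element of the second Wiener chaos of an isonormal process, normalized so that $\mathbb{E}[F_n^2]=1$. Let $\Delta(F_n)=\sum_{k\ge1}\alpha_{n,k}^2\prod_{r=1}^q(\alpha_{n,k}-\alpha_{\infty,r})^2$. Then there exists a constant $C>0$ depending only on the target $F_\infty$ (hence independent of $n$) such that: (a) $$d_{\mathbf{W}_2}(F_n,F_\infty)\le C\bigg(\sqrt{\Delta(F_n)}+\sum_{r=2}^{q+1}|\kappa_r(F_n)-\kappa_r(F_\infty)|\bigg).$$ (b) If moreover $\dim_{\mathbb{Q}}\operatorname{span}\{\alpha_{\infty,1}^2,\dots,\alpha_{\infty,q}^2\}=q$, then $d_{\mathbf{W}_2}(F_n,F_\infty)\le C\sqrt{\Delta(F_n)}$. Consequently the sole convergence $\Delta(F_n)\to\Delta(F_\infty)=0$ is sufficient for convergence in distribution of $F_n$ to $F_\infty$.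
   Context: $\kappa_r(\cdot)$ denotes the $r$-th cumulant. $\dim_{\mathbb{Q}}\operatorname{span}$ is the dimension of the $\mathbb{Q}$-linear span inside $\mathbb{R}$. The series defining $F_n$ converges in $L^2$ (every element of the second Wiener chaos of an isonormal Gaussian process has such a representation). $\Delta(F_\infty)$ is the same expression as $\Delta(F_n)$ with the coefficients of $F_\infty$ in place of those of $F_n$. $d_{\mathbf{W}_2}(F,G)$ is the Wasserstein distance of order 2 between the laws of real square-integrable random variables $F$ and $G$: $d_{\mathbf{W}_2}(F,G)=\big(\inf\mathbb{E}|X-Y|^2\big)^{1/2}$, the infimum being over all pairs $(X,Y)$ of random variables on a common probability space with $X$ distributed as $F$ and $Y$ distributed as $G$. *)

(* Defs.v *)
From HB Require Import structures.
From mathcomp Require Import all_boot all_order all_algebra finmap.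
From mathcomp Require Import all_classical all_reals all_analysis.

Set Implicit Arguments.
Unset Strict Implicit.
Unset Printing Implicit Defensive.

Import Order.TTheory GRing.Theory Num.Theory.
Import numFieldNormedType.Exports.

Local Open Scope classical_set_scope.
Local Open Scope ring_scope.

Section random_variables.
Context (R : realType).

(* Laws are compared on measurable sets only: a [{measure set _ -> \bar R}] is
   a total function, whose values on other sets are irrelevant. *)
Definition same_law d (T : measurableType d) (P : probability T R)
    (X : {RV P >-> R}) d' (T' : measurableType d') (P' : probability T' R)
    (Y : {RV P' >-> R}) :=
  forall A : set R, measurable A -> distribution P X A = distribution P' Y A.

Definition converges_in_law d (T : measurableType d) (P : probability T R)
    (X : nat -> {RV P >-> R}) d' (T' : measurableType d')
    (P' : probability T' R) (Y : {RV P' >-> R}) :=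
  forall x : R, {for x, continuous (@cdf _ _ _ P' Y)} ->
    @cdf _ _ _ P (X n) x @[n --> \oo] --> @cdf _ _ _ P' Y x.

Definition dW2 d (T : measurableType d) (P : probability T R)
    (F : {RV P >-> R}) d' (T' : measurableType d') (P' : probability T' R)
    (G : {RV P' >-> R}) : \bar R :=
  sqrte (ereal_inf [set v : \bar R |
    exists (e : measure_display) (S : measurableType e) (Q : probability S R)
           (X Y : {RV Q >-> R}),
      [/\ same_law X F, same_law Y G &
          v = 'E_Q[(fun w => ((X w - Y w) ^+ 2)%R)]%E]]).

(* The cumulant generating function ln E[exp(tX)] is finite near t = 0 for
   every X in the second Wiener chaos, so the total functions [fine], [ln] and
   [derive1n] do not return default values there. *)
Definition cumulant d (T : measurableType d) (P : probability T R)
    (X : {RV P >-> R}) (r : nat) : R :=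
  derive1n r (fun t : R => ln (fine ('M_P X t))) 0.

Section gaussian.
Context d (T : measurableType d) (P : probability T R).
Implicit Type N : nat -> {RV P >-> R}.

Definition mutually_independent N :=
  forall (J : {fset nat}) (A : nat -> set R), (forall k, measurable (A k)) ->
    P (\bigcap_(k in [set` J]) (N k @^-1` A k)) =
    (\prod_(k <- J) P (N k @^-1` A k))%E.

Definition iid_standard_normal N :=
  (forall k (A : set R), measurable A ->
     distribution P (N k) A = normal_prob 0 1 A) /\
  mutually_independent N.

(* F = \sum_k a_k (N_k^2 - 1) in L^2(P); indices start from 0. *)
Definition chaos_expansion N (a : nat -> R) (F : {RV P >-> R}) :=
  'E_P[(fun w =>
    ((F w - \sum_(k < m) a k * (N k w ^+ 2 - 1)) ^+ 2)%R)]%E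
    @[m --> \oo] --> 0%E.

End gaussian.

Definition pad q (b : 'I_q -> R) (k : nat) : R :=
  if insub k is Some i then b i else 0.

(* [Delta b a] is the quantity attached to the coefficients [a] for the target
   whose non-zero coefficients are [b]. *)
Definition Delta q (b : 'I_q -> R) (a : nat -> R) : \bar R :=
  (\sum_(0 <= k <oo) (a k ^+ 2 * \prod_(r < q) (a k - b r) ^+ 2)%:E)%E.

Definition rat_span n (b : 'I_n -> R) : set R :=
  [set x | exists c : 'I_n -> rat, x = \sum_(i < n) ratr (c i) * b i].

Definition rat_free n (b : 'I_n -> R) :=
  forall c : 'I_n -> rat, \sum_(i < n) ratr (c i) * b i = 0 ->
    forall i, c i = 0.

Definition rat_dim (V : set R) (n : nat) :=
  exists b : 'I_n -> R, rat_free b /\ V = rat_span b.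

End random_variables.

(* Main.v *)
(** Write [Q x = x^2 * prod_r (x - b_r)^2] with [b] the target coefficients, so
    that [Delta = sum_k Q (a_k)].  Rounding each [a_k] to the nearby [b_r], or to
    [0] if there is none, moves [a] by at most [C * sqrt Delta] in [l^2], hence
    [F_n] is within [C * sqrt Delta] in [L^2] of a sum in which [b_r] occurs [m_r]
    times.  When [Delta] is small, the power sums of the rounded coefficients are
    close to those of [a], so:
    - if the cumulants of orders [2..q+1] of [F_n] and of the target are close,
      interpolation at the [b_r] by polynomials divisible by [x^2] gives [m_r = 1];
    - if the [b_r^2] are independent over the rationals, the bounded integers [m_r]
      satisfy [sum_r m_r b_r^2 = sum_r b_r^2], because both second moments are [1],
      and again [m_r = 1].
    When all [m_r = 1] the target can be coupled with [F_n] by moving its variables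
    to the indices of the rounded coefficients; otherwise the right-hand side is
    bounded below and the trivial bound [dW2 <= 2] suffices. *)

Require Import Defs.
From HB Require Import structures.
From mathcomp Require Import all_boot all_order all_algebra finmap.
From mathcomp Require Import all_classical all_reals all_analysis.
From mathcomp Require Import measurable_realfun ring lra.
Set Implicit Arguments.
Unset Strict Implicit.
Unset Printing Implicit Defensive.
Import Order.TTheory GRing.Theory Num.Theory.
Import numFieldNormedType.Exports.
Local Open Scope classical_set_scope.
Local Open Scope ring_scope.

(** * Gaussian integrals and independence *)

(** [Delta] controls only the [l^2] size of the rounding error, while power sums run over infinitely
    many coefficients. The link is that every test function used vanishes to second order at [0]:
    rounding [x] to [y] changes it by at most [K |x - y| (|x| + |y|)], which is summable because
    [sum_k a_k^2] is bounded. Hence the factor [x^2] in the interpolating polynomials; the [q]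
    orders from [2] to [q + 1] are then exactly enough to isolate [q] multiplicities. Since the
    multiplicities are integers, rough accuracy suffices: an error below [1] in the first case, and
    in the second an error below the smallest non-zero value of [|sum_r m_r b_r^2 - sum_r b_r^2|]
    over finitely many admissible vectors. These thresholds depend on the [b_r] alone, which makes
    [C] independent of [n]. Cumulants are derivatives at [0] of the logarithm of an integral, so
    their expression as multiples of power sums has to be derived: independence gives the Laplace
    transform of finite sums, exponential moment bounds carry it to the [L^2] limit near [0], and
    uniform quadratic remainders allow the resulting series to be differentiated term by term. *)

Section gauss.
Context (R : realType).
Implicit Types t x : R.
Local Notation mu := (@lebesgue_measure R).

Lemma ge0_integral_normal_prob (f : R -> \bar R) :
  measurable_fun [set: R] f -> (forall x, (0 <= f x)%E) ->
  (\int[normal_prob (0:R) 1]_x f x = \int[mu]_x (f x * (normal_pdf 0 1 x)%:E))%E.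
Proof.
move=> mf f0.
have dom := @normal_prob_dominates R 0 1.
rewrite -(Radon_Nikodym_SigmaFinite.change_of_variables dom)//.
apply: ae_eq_integral => //.
- apply: emeasurable_funM => //; apply: (measurable_int mu).
  exact: Radon_Nikodym_SigmaFinite.f_integrable.
- apply: emeasurable_funM => //; apply/measurable_EFinP.
  exact: measurable_normal_pdf.
- apply: ae_eqe_mul2l; apply: integral_ae_eq => //.
  + exact: Radon_Nikodym_SigmaFinite.f_integrable.
  + by apply/measurable_EFinP; exact: measurable_normal_pdf.
  + by move=> E _ mE; rewrite -Radon_Nikodym_SigmaFinite.f_integral.
Qed.

(* [phi] is the cumulant generating function of [N^2 - 1]. *)
Definition phi t : R := - t - ln (1 - 2 * t) / 2.

Lemma integral_normal_chi2 t : t < 2^-1 ->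
  (\int[normal_prob (0:R) 1]_x (expR (t * (x ^+ 2 - 1)))%:E = (expR (phi t))%:E)%E.
Proof.
move=> t2.
have u0 : 0 < 1 - 2 * t by lra.
rewrite ge0_integral_normal_prob; last 2 first.
- apply/measurable_EFinP; apply: measurableT_comp => //.
  by apply: measurable_funM => //; apply: measurable_funB.
- by move=> x; rewrite lee_fin expR_ge0.
pose s := (Num.sqrt (1 - 2 * t))^-1.
have s0 : s != 0 by rewrite invr_eq0 sqrtr_eq0 -ltNge.
have s2 : s ^+ 2 = (1 - 2 * t)^-1 by rewrite exprVn sqr_sqrtr// ltW.
have -> : expR (phi t) = expR (- t) * s.
  rewrite /phi expRD; congr (_ * _); rewrite /s -(@lnK _ (Num.sqrt _)); last first.
    by rewrite posrE sqrtr_gt0.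
  rewrite -expRN -[in LHS](sqr_sqrtr (ltW u0)) lnXn ?sqrtr_gt0//.
  by congr expR; lra.
(* [exp (t x^2)] times the standard density is [s] times the centered normal
   density with standard deviation [s]. *)
transitivity (\int[mu]_x ((expR (- t) * s)%:E * (normal_pdf 0 s x)%:E))%E.
  apply: eq_integral => x _; rewrite -!EFinM; congr EFin.
  rewrite !normal_pdfE ?oner_eq0// /normal_peak /normal_fun s2.
  rewrite !subr0 expr1n mul1r.
  have -> : Num.sqrt ((1 - 2 * t)^-1 * pi *+ 2) = s * Num.sqrt (pi *+ 2) :> R.
    by rewrite -mulrnAr sqrtrM ?invr_ge0 ?(ltW u0)// sqrtrV// ltW.
  have expE : expR (t * (x ^+ 2 - 1)) * expR (- x ^+ 2 / (1 *+ 2)) =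
      expR (- t) * expR (- x ^+ 2 / ((1 - 2 * t)^-1 *+ 2)).
    by rewrite -!expRD; congr expR; field; rewrite gt_eqF.
  by rewrite invfM mulrCA expE -!mulrA mulVKf// mulrCA.
rewrite ge0_integralZl//=.
- by rewrite integral_normal_pdf mule1.
- by apply/measurable_EFinP; exact: measurable_normal_pdf.
- by move=> x _; rewrite lee_fin normal_pdf_ge0.
- by rewrite lee_fin mulr_ge0 ?expR_ge0// invr_ge0 sqrtr_ge0.
Qed.

End gauss.

Section independence.
Context (R : realType) d (T : measurableType d) (P : probability T R).
Implicit Types (X Y : T -> R) (J : {fset nat}).

Definition indep2 X Y := forall A B : set R, measurable A -> measurable B ->
  P (X @^-1` A `&` Y @^-1` B) = (P (X @^-1` A) * P (Y @^-1` B))%E.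

(** Independence on rectangles determines the joint law, by uniqueness of the product measure;
    Tonelli does the rest. *)
Lemma ge0_integral_indep2 (X Y : {RV P >-> R}) (f : R * R -> \bar R) :
  indep2 X Y -> measurable_fun [set: R * R] f -> (forall z, 0 <= f z)%E ->
  (\int[P]_w f (X w, Y w) =
   \int[distribution P X]_x \int[distribution P Y]_y f (x, y))%E.
Proof.
move=> XY mf f0.
pose Z : T -> R * R := fun w => (X w, Y w).
have mZ : measurable_fun [set: T] Z by apply/measurable_fun_pairP; split.
have <- : (\int[pushforward P Z]_z f z = \int[P]_w f (Z w))%E.
  by rewrite ge0_integral_pushforward.
rewrite -(fubini_tonelli1 f)//.
apply: eq_measure_integral => //= A mA _; apply/esym.
pose mZ' := isMeasurableFun.Build _ _ _ _ Z mZ.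
pose Z' : {mfun T >-> (R * R)%type} := HB.pack Z mZ'.
transitivity (distribution P Z' A) => //.
by apply: product_measure_unique => // B C mB mC; exact: XY.
Qed.

Variable N : nat -> {RV P >-> R}.

(** Each [A k] may be the whole line, so one intersection over all of [J] yields a class stable
    under intersection that generates the sigma-algebra of the [N k] with [k \in J]. *)
Definition cylinders J := [set B : set T | exists2 A : nat -> set R,
  forall k, measurable (A k) & B = \bigcap_(k in [set` J]) (N k @^-1` A k)].

(** A second measurable structure on [T]: being a function of the [N k] with [k \in J] becomes an
    ordinary [measurable_fun]. *)
Definition sigma J := g_sigma_algebraType (cylinders J).

Lemma cylinders_measurable J : cylinders J `<=` measurable.
Proof.
move=> _ [A mA ->]; apply: fin_bigcap_measurable => // k _.
by rewrite -[X in measurable X]setTI; exact: measurable_funP.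
Qed.

Lemma measurable_fun_sigma J k : k \in J ->
  measurable_fun [set: sigma J] (N k : sigma J -> R).
Proof.
move=> kJ _ A mA; rewrite setTI; apply: sub_sigma_algebra.
exists (fun j => if j == k then A else setT); first by move=> j; case: ifP.
apply/seteqP; split=> [w Aw j /= _|w /(_ k)/=]; last by rewrite eqxx; exact.
by case: ifP => // /eqP ->.
Qed.

Hypothesis indN : mutually_independent N.

(** For fixed [E], the finite measures [P (B & E)] and [P B * P E] of [B] agree on cylinders, hence
    on the sigma-algebra they generate. *)
Lemma sigma_independent J k (B : set T) (A : set R) : k \notin J ->
  <<s cylinders J >> B -> measurable A ->
  P (B `&` N k @^-1` A) = (P B * P (N k @^-1` A))%E.
Proof.
move=> kJ sB mA.
have mE : measurable (N k @^-1` A).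
  by rewrite -[X in measurable X]setTI; exact: measurable_funP.
set E := N k @^-1` A in mE *.
have PE : P E = (fine (P E))%:E by rewrite fineK// fin_num_measure.
pose c := NngNum (fine_ge0 (measure_ge0 P E)).
have cE (F : set T) : mscale c P F = (P F * P E)%E by rewrite /mscale/= PE muleC.
rewrite -cE -[LHS]/(mrestr P mE B).
apply: (g_sigma_algebra_measure_unique (cylinders J) (@cylinders_measurable J)
  (fun=> setT)) => //.
- by move=> _; exists (fun=> setT) => //; apply/seteqP; split.
- by apply/seteqP; split=> // w _; exists 0%N.
- move=> _ _ [A1 mA1 ->] [A2 mA2 ->]; exists (fun k => A1 k `&` A2 k).
    by move=> j; exact: measurableI.
  by rewrite -bigcapI.
- move=> _ [A1 mA1 ->].
  transitivity (P (\bigcap_(j in [set` J]) N j @^-1` A1 j) * P E)%E; last by rewrite -cE.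
  rewrite /mrestr (indN J mA1).
  pose A2 j := if j == k then A else A1 j.
  have mA2 j : measurable (A2 j) by rewrite /A2; case: ifP.
  have := indN (k |` J)%fset mA2; rewrite big_fsetU1//= /A2 eqxx => /esym.
  rewrite (eq_big_seq (fun j => P (N j @^-1` A1 j))); last first.
    by move=> j jJ /=; case: eqP => // jk; rewrite -jk jJ in kJ.
  rewrite muleC => ->; congr (P _).
  apply/seteqP; split=> [w [JA Aw] j /=|w JA].
    rewrite !inE => /predU1P[->|jJ]; first by rewrite eqxx.
    by case: eqP => [->//|_]; exact: JA.
  split=> [j /= jJ|].
    have := JA j; rewrite /= !inE jJ orbT => /(_ isT).
    by case: eqP => // jk; rewrite -jk jJ in kJ.
  by have := JA k; rewrite /= !inE eqxx; exact.
- by move=> _; change (P (setT `&` E) < +oo)%E; rewrite setTI PE ltry.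
Qed.

Lemma sigma_indep2 J k X : k \notin J ->
  measurable_fun [set: sigma J] (X : sigma J -> R) -> indep2 X (N k).
Proof.
move=> kJ mX A B mA mB; apply: sigma_independent kJ _ mB.
by have := mX measurableT A mA; rewrite setTI.
Qed.

End independence.

Section phi_bounds.
Context (R : realType).
Implicit Types t x : R.

Lemma phi_ge0 t : t < 2^-1 -> 0 <= phi t.
Proof.
move=> t2; rewrite /phi; suff : ln (1 - 2 * t) <= - 2 * t by lra.
by have := @le_ln1Dx R (- 2 * t); rewrite mulNr => -> //; lra.
Qed.

(** The lower bound on [ln (1 - 2 t)] comes from [ln (1 + x) <= x] at [x = 1 / (1 - 2 t) - 1]. *)
Lemma phi_le t : t <= 4^-1 -> phi t <= 4 * t ^+ 2.
Proof.
move=> t4; have u0 : 0 < 1 - 2 * t by lra.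
have := @le_ln1Dx R ((1 - 2 * t)^-1 - 1).
have v0 : 0 < (1 - 2 * t)^-1 by rewrite invr_gt0.
have -> : 1 + ((1 - 2 * t)^-1 - 1) = (1 - 2 * t)^-1 by lra.
rewrite lnV ?posrE// => /(_ ltac:(lra)) lnu.
rewrite /phi; have : (1 - 2 * t)^-1 - 1 <= 2 * t + 8 * t ^+ 2; last by lra.
rewrite lerBlDr -[_^-1]mul1r ler_pdivrMr//.
have -> : (2 * t + 8 * t ^+ 2 + 1) * (1 - 2 * t) = 1 + 4 * t ^+ 2 * (1 - 4 * t) by ring.
by rewrite lerDl mulr_ge0//; [rewrite mulr_ge0// sqr_ge0|lra].
Qed.

Lemma expR_le1D2x x : 0 <= x <= 2^-1 -> expR x <= 1 + 2 * x.
Proof.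
move=> /andP[x0 x2]; have := @expR_ge1Dx R (- x).
rewrite expRN => h.
have u0 : 0 < 1 - x by lra.
rewrite -[leLHS]invrK; apply: (@le_trans _ _ (1 - x)^-1).
  by rewrite lef_pV2 ?posrE// ?invr_gt0 ?expR_gt0//.
rewrite -[leLHS]mul1r ler_pdivrMr//.
have -> : (1 + 2 * x) * (1 - x) = 1 + x * (1 - 2 * x) by ring.
by rewrite lerDl mulr_ge0//; lra.
Qed.

(** Squaring [x / 2 <= exp (x / 2)]. This dominates squares by exponentials, whose Gaussian
    integrals are known. *)
Lemma sqr_le_expR x : x ^+ 2 <= 4 * (expR x + expR (- x)).
Proof.
wlog x0 : x / 0 <= x.
  move=> h; have [/h//|x0] := leP 0 x.
  have := h (- x); rewrite sqrrN opprK [expR (- x) + _]addrC; apply.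
  by rewrite oppr_ge0 ltW.
have h : x / 2 <= expR (x / 2) by have := @expR_ge1Dx R (x / 2); lra.
have : (x / 2) ^+ 2 <= expR (x / 2) ^+ 2 by rewrite lerXn2r ?nnegrE ?expR_ge0//; lra.
have -> : expR (x / 2) ^+ 2 = expR x by rewrite -expRM_natl; congr expR; lra.
have := expR_ge0 (- x); lra.
Qed.

End phi_bounds.

Section chi2.
Context (R : realType).
Local Notation g := (normal_prob (0 : R) 1).
Local Notation H := (fun x : R => x ^+ 2 - 1).

Lemma measurable_chi2 : measurable_fun [set: R] H.
Proof. by apply: measurable_funB => //; exact: measurable_funX. Qed.

Lemma integrable_sqr_chi2 : g.-integrable [set: R] (fun x => (H x ^+ 2)%:E).
Proof.
have mexp (t : R) :
    measurable_fun [set: R] (fun x => (expR (t * (x ^+ 2 - 1)))%:E).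
  apply/measurable_EFinP; apply: measurableT_comp => //.
  by apply: measurable_funM => //; exact: measurable_chi2.
apply/integrableP; split.
  by apply/measurable_EFinP; apply: measurable_funX; exact: measurable_chi2.
(* [sqr_le_expR] is applied to a quarter of [H x], whence [64 = 16 * 4]; both exponents [1/4] and
   [-1/4] lie below [1/2], where the integral is finite. *)
apply: (@le_lt_trans _ _ (\int[g]_x (64%:E * ((expR (4^-1 * (x ^+ 2 - 1)))%:E +
   (expR ((- 4^-1) * (x ^+ 2 - 1)))%:E)))%E).
  apply: ge0_le_integral => //=.
  - apply/measurable_EFinP; apply: measurableT_comp => //.
    by apply: measurable_funX; exact: measurable_chi2.
  - by apply: emeasurable_funM => //; apply: emeasurable_funD; exact: mexp.
  - move=> x _; rewrite -EFinD -EFinM lee_fin ger0_norm ?sqr_ge0//.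
    have := @sqr_le_expR R (4^-1 * (x ^+ 2 - 1)); rewrite exprMn -mulNr.
    lra.
rewrite ge0_integralZl//=; last 2 first.
- by apply: emeasurable_funD; exact: mexp.
- by move=> x _; rewrite -EFinD lee_fin addr_ge0 ?expR_ge0.
rewrite ge0_integralD//=; try exact: mexp; try by move=> x _; rewrite lee_fin expR_ge0.
by rewrite !integral_normal_chi2 ?ltry//; lra.
Qed.

Lemma integrable_chi2 : g.-integrable [set: R] (fun x => (H x)%:E).
Proof.
have := integrable_sqr_chi2 => /(integrableD measurableT
  (finite_measure_integrable_cst g 1 measurableT : g.-integrable [set: R] (cst 1%:E))).
apply: le_integrable => //.
  by apply/measurable_EFinP; exact: measurable_chi2.
move=> x _ /=; rewrite lee_fin; set h := x ^+ 2 - 1.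
rewrite [leRHS]ger0_norm ?addr_ge0 ?sqr_ge0//.
by rewrite ler_norml; apply/andP; split; nra.
Qed.

Lemma integral_chi2 : (\int[g]_x (H x)%:E = 0)%E.
Proof.
have /fineK <- := integrable_fin_num measurableT integrable_chi2.
set m := fine _; congr EFin.
(* [1 + t m <= E (exp (t H)) = exp (phi t)] and [phi t = O(t^2)], for [t] of both
   signs. *)
have mle (t : R) : t <= 8^-1 -> - 8^-1 <= t -> t * m <= 8 * t ^+ 2.
  move=> t8 t8'.
  have : ((1 + t * m)%:E <= (expR (phi t))%:E)%E.
    rewrite -integral_normal_chi2; last by lra.
    have -> : ((1 + t * m)%:E = \int[g]_x (1%:E + t%:E * (H x)%:E))%E.
      rewrite integralD//=; last 2 first.
      - exact: finite_measure_integrable_cst.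
      - by apply: integrableZl => //; exact: integrable_chi2.
      rewrite integralZl//=; last exact: integrable_chi2.
      rewrite integral_cst//= probability_setT mule1 EFinD EFinM /m.
      by rewrite fineK//; exact: integrable_fin_num integrable_chi2.
    apply: le_integral => //=.
    - apply: integrableD => //=; first exact: finite_measure_integrable_cst.
      by apply: integrableZl => //; exact: integrable_chi2.
    - apply/integrableP; split.
        apply/measurable_EFinP; apply: measurableT_comp => //.
        by apply: measurable_funM => //; exact: measurable_chi2.
      under eq_integral do rewrite gee0_abs ?lee_fin ?expR_ge0//.
      by rewrite integral_normal_chi2 ?ltry//; lra.
    - move=> x _; rewrite -EFinM -EFinD lee_fin.
      exact: expR_ge1Dx.
  rewrite lee_fin => h1.
  have h2 : phi t <= 4 * t ^+ 2 by apply: phi_le; lra.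
  have h3 : 0 <= phi t by apply: phi_ge0; lra.
  have h4 : expR (phi t) <= 1 + 2 * phi t.
    by apply: expR_le1D2x; rewrite h3/=; nra.
  by lra.
apply/eqP; rewrite eq_le; apply/andP; split.
  rewrite leNgt; apply/negP => m0.
  (* With this [t], the bound [t m <= 8 t^2] gives [m <= 8 t <= m / 2], a contradiction. *)
  pose t := Num.min (8^-1) (m / 16) : R.
  have t0 : 0 < t by rewrite lt_min; apply/andP; split; lra.
  have tm : t <= m / 16 by rewrite ge_min lexx orbT.
  have t8 : t <= 8^-1 by rewrite ge_min lexx.
  have := mle t t8; rewrite expr2 mulrCA ler_pM2l// => h.
  by have := h ltac:(lra); lra.
rewrite leNgt; apply/negP => m0.
pose t := Num.min (8^-1) (- m / 16) : R.
have t0 : 0 < t by rewrite lt_min; apply/andP; split; lra.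
have tm : t <= - m / 16 by rewrite ge_min lexx orbT.
have t8 : t <= 8^-1 by rewrite ge_min lexx.
have := mle (- t); rewrite sqrrN mulNr -mulrN expr2 mulrCA ler_pM2l// => h.
by have := h ltac:(lra) ltac:(lra); lra.
Qed.

(** The value [2] is never computed. Both second moments equal [1], so this constant cancels when
    the sums of squared coefficients are compared. *)
Definition chi2_var : R := fine (\int[g]_x (H x ^+ 2)%:E)%E.

Lemma chi2_varE : (\int[g]_x (H x ^+ 2)%:E = chi2_var%:E)%E.
Proof.
by rewrite /chi2_var fineK//; exact: integrable_fin_num integrable_sqr_chi2.
Qed.

Lemma chi2_var_ge0 : 0 <= chi2_var.
Proof. by rewrite fine_ge0//; apply: integral_ge0 => x _; rewrite lee_fin sqr_ge0. Qed.

Lemma integral_sqr_affine_chi2 (x a : R) :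
  (\int[g]_y ((x + a * H y) ^+ 2)%:E = (x ^+ 2 + a ^+ 2 * chi2_var)%:E)%E.
Proof.
transitivity (\int[g]_y (((x ^+ 2)%:E + (2 * x * a)%:E * (H y)%:E) +
   (a ^+ 2)%:E * (H y ^+ 2)%:E))%E.
  by apply: eq_integral => y _; rewrite -!EFinM -!EFinD; congr EFin; ring.
have i1 : g.-integrable [set: R] (cst (x ^+ 2)%:E).
  exact: finite_measure_integrable_cst.
have i2 : g.-integrable [set: R] (fun y => ((2 * x * a)%:E * (H y)%:E)%E).
  by apply: integrableZl => //; exact: integrable_chi2.
have i3 : g.-integrable [set: R] (fun y => ((a ^+ 2)%:E * (H y ^+ 2)%:E)%E).
  by apply: integrableZl => //; exact: integrable_sqr_chi2.
rewrite integralD//; last exact: integrableD.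
rewrite integralD// integral_cst//= probability_setT mule1.
rewrite integralZl//; last exact: integrable_chi2.
rewrite integralZl//; last exact: integrable_sqr_chi2.
by rewrite integral_chi2 chi2_varE mule0 adde0 -EFinM -EFinD.
Qed.

End chi2.

(** * Finite sums of weighted centred squares *)

Section chi2_sums.
Context (R : realType) d (T : measurableType d) (P : probability T R).
Local Notation g := (normal_prob (0 : R) 1).
Variable N : nat -> {RV P >-> R}.

(** The map [tau] is [id] for the partial sums of a chaos element, and an injection for a copy of
    the target carried by other variables. *)
Definition chi2_sum (tau : nat -> nat) (c : nat -> R) m (w : T) : R :=
  \sum_(k < m) c k * (N (tau k) w ^+ 2 - 1).

Lemma chi2_sumS tau c m w : chi2_sum tau c m.+1 w =
  chi2_sum tau c m w + c m * (N (tau m) w ^+ 2 - 1).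
Proof. by rewrite /chi2_sum big_ord_recr. Qed.

Lemma measurable_chi2_sum_sigma (J : {fset nat}) tau c m :
  (forall k, (k < m)%N -> tau k \in J) ->
  measurable_fun [set: sigma N J] (chi2_sum tau c m : sigma N J -> R).
Proof.
move=> tauJ; rewrite /chi2_sum; apply: measurable_sum => k; apply: measurable_funM => //.
apply: measurable_funB => //; apply: measurable_funX.
by apply: measurable_fun_sigma; exact: tauJ.
Qed.

Lemma measurable_chi2_sum tau c m : measurable_fun [set: T] (chi2_sum tau c m).
Proof.
rewrite /chi2_sum; apply: measurable_sum => k; apply: measurable_funM => //.
by apply: measurable_funB => //; apply: measurable_funX.
Qed.

Definition chi2_sumRV tau c m : {RV P >-> R} :=
  HB.pack (chi2_sum tau c m)
    (isMeasurableFun.Build _ _ _ _ _ (measurable_chi2_sum tau c m)).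

Hypothesis iidN : iid_standard_normal N.

(* [normal_prob] and the law of [N k] live on two copies of the Borel
   sigma-algebra with different displays, whence the transfer along [id]. *)
Lemma ge0_integral_iidN k (f : R -> \bar R) :
  measurable_fun [set: R] f -> (forall x, 0 <= f x)%E ->
  (\int[distribution P (N k)]_x f x = \int[g]_x f x)%E.
Proof.
move=> mf f0; pose i (x : R) : measurableTypeR R := x.
have mi : measurable_fun [set: R] i by move=> _ A mA; rewrite setTI.
transitivity (\int[pushforward (distribution P (N k)) i]_x f x)%E.
  by rewrite (ge0_integral_pushforward mi).
apply: (@eq_measure_integral _ (measurableTypeR R) R) => A mA _.
exact: (iidN.1 k A mA).
Qed.

(** By injectivity of [tau], the last variable is independent of the preceding sum and can be
    integrated out. The law, the Laplace transform and the second moment of these sums all follow by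
    induction on this step. *)
Lemma ge0_integral_chi2_sumS tau c m (f : R -> \bar R) :
  (forall j k, (j <= m)%N -> (k <= m)%N -> tau j = tau k -> j = k) ->
  measurable_fun [set: R] f -> (forall x, 0 <= f x)%E ->
  (\int[P]_w f (chi2_sum tau c m.+1 w) = 
   \int[distribution P (chi2_sumRV tau c m)]_x
     \int[g]_y f (x + c m * (y ^+ 2 - 1))%R)%E.
Proof.
move=> tau_inj mf f0.
pose J := [fset tau (val k) | k : 'I_m]%fset.
have mJ : tau m \notin J.
  apply/imfsetP => -[/= k _ /tau_inj] => /(_ (leqnn m) (ltnW (ltn_ord k))) mk.
  by have := ltn_ord k; rewrite -mk ltnn.
have ind : indep2 P (chi2_sumRV tau c m) (N (tau m)).
  apply: (sigma_indep2 iidN.2 mJ); apply: measurable_chi2_sum_sigma => k km.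
  by apply/imfsetP; exists (Ordinal km).
under eq_integral do rewrite chi2_sumS.
pose F (z : R * R) := f (z.1 + c m * (z.2 ^+ 2 - 1)).
have mF : measurable_fun [set: R * R] F.
  apply: measurableT_comp => //; apply: measurable_funD => //.
  apply: measurable_funM => //; apply: measurable_funB => //.
  exact: measurable_funX.
have F0 z : (0 <= F z)%E by exact: f0.
rewrite (@ge0_integral_indep2 _ _ _ _ (chi2_sumRV tau c m) (N (tau m)) F)//=.
apply: eq_integral => x _; rewrite ge0_integral_iidN//.
by apply: measurableT_comp => //; exact: measurable_pair1.
Qed.

(** An i.i.d. family read along an injection keeps its joint law. This is what makes the displaced
    target a legitimate partner in a coupling. *)
Lemma distribution_chi2_sum tau c m :
  (forall j k, (j < m)%N -> (k < m)%N -> tau j = tau k -> j = k) ->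
  forall A : set R, measurable A ->
  P (chi2_sum tau c m @^-1` A) = P (chi2_sum id c m @^-1` A).
Proof.
elim: m => [|m IHm] tau_inj A mA.
  congr (P _); apply/seteqP.
  by split=> w /=; rewrite /chi2_sum !big_ord0.
have indE t : P (chi2_sum t c m.+1 @^-1` A) =
    (\int[P]_w (\1_A (chi2_sum t c m.+1 w))%:E)%E.
  rewrite (_ : (\int[P]_w (\1_A (chi2_sum t c m.+1 w))%:E)%E =
     \int[P]_w (\1_(chi2_sum t c m.+1 @^-1` A) w)%:E)%E//.
  rewrite integral_indic ?setIT//.
  by rewrite -[X in measurable X]setTI; apply: measurable_chi2_sum.
rewrite !indE.
have mA1 : measurable_fun [set: R] (fun x => (\1_A x)%:E : \bar R).
  by apply/measurable_EFinP; exact: measurable_indic.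
rewrite (@ge0_integral_chi2_sumS _ _ _ (fun x => (\1_A x)%:E))//.
rewrite (@ge0_integral_chi2_sumS _ _ _ (fun x => (\1_A x)%:E))//.
(* The inner Gaussian integral no longer mentions [tau], so only the laws of the shorter sums remain
   to be compared. *)
apply: eq_measure_integral => B mB _.
by apply: IHm => // j k jm km; apply: tau_inj; rewrite ltnW.
Qed.

Lemma integral_expR_chi2_sum c m (t : R) :
  (forall k, (k < m)%N -> t * c k < 2^-1) ->
  (\int[P]_w (expR (t * chi2_sum id c m w))%:E =
    (expR (\sum_(k < m) phi (t * c k)))%:E)%E.
Proof.
elim: m => [|m IHm] tc.
  under eq_integral do rewrite /chi2_sum big_ord0 mulr0 expR0.
  by rewrite integral_cst//= probability_setT mule1 big_ord0 expR0.
have mexp : measurable_fun [set: R] (fun x : R => (expR (t * x))%:E : \bar R).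
  by apply/measurable_EFinP/measurableT_comp => //; exact: measurable_funM.
rewrite (@ge0_integral_chi2_sumS _ _ _ (fun x => (expR (t * x))%:E))//.
transitivity (\int[distribution P (chi2_sumRV id c m)]_x
  ((expR (phi (t * c m)))%:E * (expR (t * x))%:E))%E.
  apply: eq_integral => x _; rewrite -(integral_normal_chi2 (tc m (leqnn _))).
  rewrite muleC -ge0_integralZl//=.
  - by apply: eq_integral => y _; rewrite -EFinM -expRD; congr (expR _)%:E; ring.
  - apply/measurable_EFinP/measurableT_comp => //; apply: measurable_funM => //.
    exact: measurable_chi2.
rewrite ge0_integralZl//=.
rewrite ge0_integral_distribution//.
rewrite IHm; last by move=> k km; apply: tc; rewrite ltnW.
by rewrite -EFinM -expRD big_ord_recr/= addrC.
Qed.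

Lemma integral_sqr_chi2_sum c m :
  (\int[P]_w (chi2_sum id c m w ^+ 2)%:E =
    (chi2_var R * \sum_(k < m) c k ^+ 2)%:E)%E.
Proof.
elim: m => [|m IHm].
  under eq_integral do rewrite /chi2_sum big_ord0 expr0n/=.
  by rewrite integral0 big_ord0 mulr0.
have msq : measurable_fun [set: R] (fun x : R => (x ^+ 2)%:E : \bar R).
  by apply/measurable_EFinP; exact: measurable_funX.
rewrite (@ge0_integral_chi2_sumS _ _ _ (fun x => (x ^+ 2)%:E))//; last first.
  by move=> x; rewrite lee_fin sqr_ge0.
under eq_integral do rewrite integral_sqr_affine_chi2 EFinD.
rewrite ge0_integralD//=; last 2 first.
- by move=> x _; rewrite lee_fin sqr_ge0.
- by move=> x _; rewrite lee_fin mulr_ge0 ?sqr_ge0 ?chi2_var_ge0.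
rewrite integral_cst//= probability_setT mule1.
rewrite ge0_integral_distribution//; last first.
  by move=> x; rewrite lee_fin sqr_ge0.
by rewrite IHm -EFinD big_ord_recr/= mulrDr [_ * chi2_var R]mulrC.
Qed.

End chi2_sums.

(** * Cumulants of elements of the second chaos *)

Section ge0_integral_bounds.
Context d (T : measurableType d) (R : realType) (P : probability T R).
Implicit Types f g h : T -> R.

Lemma ge0_integral_leD f g h (c : R) : 0 <= c ->
  measurable_fun [set: T] f -> measurable_fun [set: T] g -> measurable_fun [set: T] h ->
  (forall w, 0 <= f w) -> (forall w, 0 <= g w) -> (forall w, 0 <= h w) ->
  (forall w, f w <= g w + c * h w) ->
  (\int[P]_w (f w)%:E <= \int[P]_w (g w)%:E + c%:E * \int[P]_w (h w)%:E)%E.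
Proof.
move=> c0 mf mg mh f0 g0 h0 fgh.
have mch : measurable_fun [set: T] (fun w => c * h w) by exact: measurable_funM.
rewrite -ge0_integralZl//=; last 2 first.
- exact/measurable_EFinP.
- by move=> w _; rewrite lee_fin.
rewrite -ge0_integralD//=; last 4 first.
- by move=> w _; rewrite lee_fin.
- exact/measurable_EFinP.
- by move=> w _; rewrite -EFinM lee_fin mulr_ge0.
- exact/measurable_EFinP.
apply: ge0_le_integral => //=.
- by move=> w _; rewrite lee_fin.
- exact/measurable_EFinP.
- by apply: emeasurable_funD; exact/measurable_EFinP.
- by move=> w _; rewrite -EFinM -EFinD lee_fin.
Qed.

(** The [L^2] triangle inequality in squared form, from [2 x y <= e x^2 + y^2 / e]. All integrands
    are non-negative, so no integrability is at stake, and [e] may be small when the two functions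
    are close. *)
Lemma integral_sqr_le f g (e : R) : 0 < e ->
  measurable_fun [set: T] f -> measurable_fun [set: T] g ->
  (\int[P]_w (f w ^+ 2)%:E <= (1 + e)%:E * \int[P]_w (g w ^+ 2)%:E +
    (1 + e^-1)%:E * \int[P]_w ((f w - g w) ^+ 2)%:E)%E.
Proof.
move=> e0 mf mg.
have e1 : 0 < e^-1 by rewrite invr_gt0.
have mg2 : measurable_fun [set: T] (fun w => g w ^+ 2) by exact: measurable_funX.
rewrite -[X in (_ <= X + _)%E]ge0_integralZl//=; last 3 first.
- exact/measurable_EFinP.
- by move=> w _; rewrite lee_fin sqr_ge0.
- by rewrite lee_fin; lra.
apply: (@ge0_integral_leD _ (fun w => (1 + e) * g w ^+ 2)).
- by lra.
- exact: measurable_funX.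
- exact: measurable_funM.
- by apply: measurable_funX; exact: measurable_funB.
- by move=> w; rewrite sqr_ge0.
- by move=> w; rewrite mulr_ge0 ?sqr_ge0//; lra.
- by move=> w; rewrite sqr_ge0.
- move=> w; rewrite -subr_ge0.
  have -> : (1 + e) * g w ^+ 2 + (1 + e^-1) * (f w - g w) ^+ 2 - f w ^+ 2 =
      e * (g w - e^-1 * (f w - g w)) ^+ 2.
    by field; rewrite gt_eqF.
  by rewrite mulr_ge0 ?sqr_ge0// ltW.
Qed.

End ge0_integral_bounds.

Section expR_bounds.
Context (R : realType).
Implicit Types x y M : R.

Lemma expR_ge_tangent x y : expR x * (1 + (y - x)) <= expR y.
Proof.
have {2}-> : y = x + (y - x) by lra.
by rewrite expRD ler_pM2l ?expR_gt0// expR_ge1Dx.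
Qed.

Lemma expR_leD x y : expR x <= expR y + `|x - y| * (expR x + expR y).
Proof.
have [xy|xy] := leP x y.
  rewrite -[leLHS]addr0 lerD ?ler_expR// mulr_ge0// addr_ge0 ?expR_ge0//.
have := expR_ge_tangent x y.
rewrite gtr0_norm ?subr_gt0// => h.
have : 0 <= (x - y) * expR y by rewrite mulr_ge0 ?expR_ge0// subr_ge0 ltW.
by lra.
Qed.

Lemma min_expR_leD x y M : 0 < M ->
  Num.min (expR x) M <= Num.min (expR y) M + M * `|x - y|.
Proof.
move=> M0; have [yM|yM] := leP M (expR y).
  by rewrite ge_min lerDl mulr_ge0 ?orbT// ltW.
have [xM|xM] := leP M (expR x).
  pose z := ln M.
  have zE : expR z = M by rewrite lnK.
  have zy : y <= z by rewrite -ler_expR zE ltW.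
  have zx : z <= x by rewrite -ler_expR zE.
  have := expR_ge_tangent z y.
  rewrite zE => h.
  have : M * (z - y) <= M * `|x - y|.
    by rewrite ler_pM2l// ger0_norm; lra.
  by lra.
have [xy|xy] := leP x y.
  by rewrite -[leLHS]addr0 lerD ?ler_expR// mulr_ge0// ltW.
have := expR_ge_tangent x y.
have : expR x * (x - y) <= M * `|x - y|.
  by rewrite ger0_norm; [rewrite ler_pM2r; lra|lra].
by lra.
Qed.

End expR_bounds.

(** * Moments of the [L^2] limit *)

Section chaos.
Context (R : realType) d (T : measurableType d) (P : probability T R).
Variables (N : nat -> {RV P >-> R}) (a : nat -> R) (F : {RV P >-> R}).
Hypothesis iidN : iid_standard_normal N.
Hypothesis aF : chaos_expansion N a F.
Local Notation S m := (chi2_sum N id a m).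

Lemma chaos_sqr_cvg0 :
  (\int[P]_w ((F w - S m w) ^+ 2)%:E)%E @[m --> \oo] --> 0%E.
Proof. by move: aF; rewrite /chaos_expansion unlock. Qed.

Lemma chaos_sqr_small (e : R) : 0 < e -> \forall m \near \oo,
  exists2 r, 0 <= r <= e & (\int[P]_w ((F w - S m w) ^+ 2)%:E = r%:E)%E.
Proof.
move=> e0; have /fine_cvgP[finE /cvgrPdist_le/(_ _ e0) small] := chaos_sqr_cvg0.
near=> m.
have fE : (\int[P]_w ((F w - S m w) ^+ 2)%:E \is a fin_num)%E by near: m.
exists (fine (\int[P]_w ((F w - S m w) ^+ 2)%:E)); last by rewrite fineK.
apply/andP; split.
  by apply/fine_ge0/integral_ge0 => w _; rewrite lee_fin sqr_ge0.
apply: le_trans (ler_norm _) _.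
rewrite -normrN -[X in `|X|]sub0r; by near: m.
Unshelve. all: by end_near. Qed.

Let mF : measurable_fun [set: T] F. Proof. exact: measurable_funP. Qed.

Let mS m : measurable_fun [set: T] (S m). Proof. exact: measurable_chi2_sum. Qed.

Lemma chaos_sum_sqr_cvg : (\int[P]_w (F w ^+ 2)%:E = 1)%E ->
  chi2_var R * \sum_(k < m) a k ^+ 2 @[m --> \oo] --> (1 : R).
Proof.
move=> F1; apply/cvgrPdist_le => e e0.
(* Writing [x] for the partial sum, [integral_sqr_le] in both directions gives [x <= 1 + 2 u <= 3]
   and [1 - x <= u x + u <= 4 u], whence [e / 4]; [s] is chosen so that [(1 + 1 / u) s = u]. *)
pose u := Num.min 1 (e / 4).
have u0 : 0 < u by rewrite lt_min ltr01 divr_gt0.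
have u1 : u <= 1 by rewrite ge_min lexx.
have ue : u <= e / 4 by rewrite ge_min lexx orbT.
have u'0 : 0 < u^-1 by rewrite invr_gt0.
pose s := u / (1 + u^-1).
have s0 : 0 < s by rewrite divr_gt0//; lra.
near=> m.
have [r /andP[r0 rs] rE] : exists2 r, 0 <= r <= s &
    (\int[P]_w ((F w - S m w) ^+ 2)%:E = r%:E)%E.
  by near: m; exact: chaos_sqr_small.
have rE' : (\int[P]_w ((S m w - F w) ^+ 2)%:E = r%:E)%E.
  by rewrite -rE; apply: eq_integral => w _; rewrite -sqrrN opprB.
have su : (1 + u^-1) * s = u by rewrite /s mulrC divfK// gt_eqF//; lra.
have ru : (1 + u^-1) * r <= u by rewrite -[leRHS]su ler_pM2l//; lra.
have := integral_sqr_le P u0 mF (mS m).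
rewrite rE F1 integral_sqr_chi2_sum// -!EFinM -EFinD lee_fin => h1.
have := integral_sqr_le P u0 (mS m) mF.
rewrite rE' F1 integral_sqr_chi2_sum// -!EFinM -EFinD lee_fin => h2.
set x := chi2_var R * _ in h1 h2 *.
have x3 : x <= 3 by lra.
have ux : u * x <= u * 3 by rewrite ler_pM2l.
by rewrite ler_norml; apply/andP; split; lra.
Unshelve. all: by end_near. Qed.

Lemma chaos_expR_le (t K : R) :
  (forall m, (\int[P]_w (expR (t * S m w))%:E <= K%:E)%E) ->
  (\int[P]_w (expR (t * F w))%:E <= K%:E)%E.
Proof.
move=> SK.
have K0 : 0 <= K.
  have := SK 0%N; rewrite -lee_fin; apply: le_trans.
  by apply: integral_ge0 => w _; rewrite lee_fin expR_ge0.
have mexp (X : T -> R) : measurable_fun [set: T] X ->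
    measurable_fun [set: T] (fun w => expR (t * X w)).
  by move=> mX; apply: measurableT_comp => //; exact: measurable_funM.
have mmin M (X : T -> R) : measurable_fun [set: T] X ->
    measurable_fun [set: T] (fun w => Num.min (expR (t * X w)) M).
  by move=> mX; apply: measurable_minr => //; exact: mexp.
(* [min (exp (t x)) M] is Lipschitz in [x], so the bound passes to the [L^2] limit
   for the truncations. *)
have truncK n : (\int[P]_w (Num.min (expR (t * F w)) n.+1%:R)%:E <= K%:E)%E.
  apply/lee_addgt0Pr => e e0.
  (* [M] is a Lipschitz constant of the truncated exponential, kept positive even for [t = 0]. The
     distance to [S m] is bounded by [u] plus its square over [u]; each part costs at most
     [M u = e / 2] once the [L^2] error is at most [u^2]. *)
  pose M : R := n.+1%:R * `|t| + 1.
  pose u := e / (2 * M).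
  have M0 : 0 < M by rewrite ltr_wpDl// mulr_ge0.
  have u0 : 0 < u by rewrite divr_gt0// mulr_gt0.
  have uu0 : 0 < u ^+ 2 by rewrite exprn_gt0.
  near \oo => m.
  have [r /andP[r0 ru] rE] : exists2 r, 0 <= r <= u ^+ 2 &
      (\int[P]_w ((F w - S m w) ^+ 2)%:E = r%:E)%E.
    by near: m; exact: chaos_sqr_small.
  apply: (@le_trans _ _ (\int[P]_w (expR (t * S m w) + M * u)%:E +
    (M / u)%:E * \int[P]_w ((F w - S m w) ^+ 2)%:E)%E).
    apply: ge0_integral_leD.
    - by rewrite divr_ge0 ?ltW.
    - exact: mmin.
    - by apply: measurable_funD => //; exact: mexp.
    - by apply: measurable_funX; exact: measurable_funB.
    - by move=> w; rewrite le_min expR_ge0/=.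
    - by move=> w; rewrite addr_ge0 ?expR_ge0// mulr_ge0 ?ltW.
    - by move=> w; rewrite sqr_ge0.
    - move=> w; have n0 : 0 < n.+1%:R :> R by rewrite ltr0n.
      have := min_expR_leD (t * F w) (t * S m w) n0.
      rewrite -mulrBr normrM mulrA => h.
      have h1 : Num.min (expR (t * S m w)) n.+1%:R <= expR (t * S m w).
        by rewrite ge_min lexx.
      have h2 : n.+1%:R * `|t| * `|F w - S m w| <= M * `|F w - S m w|.
        by rewrite ler_wpM2r// lerDl.
      have h3 : `|F w - S m w| <= u + (F w - S m w) ^+ 2 / u.
        rewrite -[_ ^+ 2]real_normK ?num_real//; set x := `|_|.
        rewrite -(ler_pM2r u0) mulrDl divfK ?gt_eqF//.
        by have := sqr_ge0 (x - u); have := normr_ge0 (F w - S m w); rewrite -/x; nra.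
      have h4 : M * `|F w - S m w| <= M * u + M / u * (F w - S m w) ^+ 2.
        by rewrite -mulrA [u^-1 * _]mulrC -mulrDr ler_pM2l.
      by lra.
  have cst0 : (\int[P]_w (expR (t * S m w) + M * u)%:E <= K%:E + (M * u)%:E)%E.
    under eq_integral do rewrite EFinD.
    rewrite ge0_integralD//=; last 2 first.
    - exact/measurable_EFinP/mexp.
    - by move=> w _; rewrite lee_fin mulr_ge0 ?ltW.
    by rewrite integral_cst//= probability_setT mule1 leeD2r.
  rewrite rE; apply: le_trans (leeD2r _ cst0) _.
  rewrite -EFinM -!EFinD lee_fin -addrA lerD2l.
  have : M / u * r <= M * u.
    by rewrite -mulrA ler_pM2l// ler_pdivrMl// -expr2.
  have : M * u = e / 2 by rewrite /u; field; rewrite gt_eqF.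
  by lra.
pose h n w := (Num.min (expR (t * F w)) n.+1%:R)%:E.
have hE w : limn (h ^~ w) = (expR (t * F w))%:E.
  apply/cvg_lim => //; apply: cvg_near_cst.
  near=> n; rewrite /h; congr EFin; apply/min_idPl.
  apply: le_trans (ltW (truncnS_gt _)) _; rewrite ler_nat ltnS.
  by near: n; exact: nbhs_infty_ge.
rewrite (_ : (\int[P]_w (expR (t * F w))%:E = \int[P]_w limn (h ^~ w))%E); last first.
  by apply: eq_integral => w _; rewrite hE.
have nd m n : (m <= n)%N -> forall w, (h m w <= h n w)%E.
  move=> mn w; rewrite lee_fin le_min ge_min lexx/= ge_min.
  by rewrite ler_nat ltnS mn orbT.
have mh n : measurable_fun [set: T] (h n) by exact/measurable_EFinP/mmin.
have h0 n w : (0 <= h n w)%E by rewrite lee_fin le_min expR_ge0/=.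
rewrite monotone_convergence//; last by move=> w _ m n mn; exact: nd.
apply: lime_le; last by apply: nearW => n; exact: truncK.
apply: ereal_nondecreasing_is_cvgn => m n mn.
by apply: ge0_le_integral => // w _; exact: nd.
Unshelve. all: by end_near. Qed.

(** [L^2] convergence alone does not carry exponential moments over. In [|exp x - exp y| <= |x - y|
    (exp x + exp y)] a weighted Young inequality leaves the squares of the exponentials, which the
    bound at [2 t] controls uniformly in [m]. *)
Lemma chaos_expR_cvg (t K l : R) (s : nat -> R) :
  (forall m, (\int[P]_w (expR (2 * t * S m w))%:E <= K%:E)%E) ->
  (forall m, (\int[P]_w (expR (t * S m w))%:E = (s m)%:E)%E) ->
  s m @[m --> \oo] --> l ->
  (\int[P]_w (expR (t * F w))%:E)%E = l%:E.
Proof.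
move=> SK Ss sl.
have FK := chaos_expR_le SK.
have K0 : 0 <= K.
  have := SK 0%N; rewrite -lee_fin; apply: le_trans.
  by apply: integral_ge0 => w _; rewrite lee_fin expR_ge0.
have mexp v (X : T -> R) : measurable_fun [set: T] X ->
    measurable_fun [set: T] (fun w => expR (v * X w)).
  by move=> mX; apply: measurableT_comp => //; exact: measurable_funM.
(* The total error is [|t| (u + 2 u K)], which is at most [u M = e] for [u = e / M]. *)
pose M : R := `|t| * (1 + 2 * K) + 1.
have M1 : 0 <= `|t| * (1 + 2 * K) by rewrite mulr_ge0//; lra.
have M0 : 0 < M by rewrite /M; lra.
have close (e : R) : 0 < e -> \forall m \near \oo,
    (\int[P]_w (expR (t * F w))%:E <= \int[P]_w (expR (t * S m w))%:E + e%:E)%E /\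
    (\int[P]_w (expR (t * S m w))%:E <= \int[P]_w (expR (t * F w))%:E + e%:E)%E.
  move=> e0; pose u := e / M; have u0 : 0 < u by rewrite divr_gt0.
  have uu0 : 0 < u ^+ 2 by rewrite exprn_gt0.
  near=> m.
  have [r /andP[r0 ru] rE] : exists2 r, 0 <= r <= u ^+ 2 &
      (\int[P]_w ((F w - S m w) ^+ 2)%:E = r%:E)%E.
    by near: m; exact: chaos_sqr_small.
  pose D w := (F w - S m w) ^+ 2 / u + u * (expR (2 * t * F w) + expR (2 * t * S m w)).
  have mD2 : measurable_fun [set: T] (fun w => (F w - S m w) ^+ 2).
    by apply: measurable_funX; exact: measurable_funB.
  have mE X : measurable_fun [set: T] X ->
      measurable_fun [set: T] (fun w => (expR (2 * t * X w))%:E).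
    by move=> mX; exact/measurable_EFinP/mexp.
  have mEE : measurable_fun [set: T] (fun w => expR (2 * t * F w) + expR (2 * t * S m w)).
    by apply: measurable_funD; exact: mexp.
  have mD : measurable_fun [set: T] D.
    by apply: measurable_funD; exact: measurable_funM.
  have D0 w : 0 <= D w.
    apply: addr_ge0; first by rewrite divr_ge0 ?sqr_ge0// ltW.
    by apply: mulr_ge0; [exact: ltW|exact: addr_ge0].
  have intD : (`|t|%:E * \int[P]_w (D w)%:E <= e%:E)%E.
    have : (\int[P]_w (D w)%:E <= (u + 2 * u * K)%:E)%E.
      under eq_integral do rewrite /D mulrC EFinD.
      rewrite ge0_integralD//=; last 4 first.
      - by move=> w _; rewrite lee_fin mulr_ge0 ?sqr_ge0// invr_ge0 ltW.
      - by apply/measurable_EFinP; exact: measurable_funM.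
      - by move=> w _; rewrite lee_fin mulr_ge0 ?addr_ge0 ?expR_ge0// ltW.
      - by apply/measurable_EFinP; exact: measurable_funM.
      under eq_integral do rewrite EFinM.
      under [X in (_ + X)%E]eq_integral do rewrite EFinM.
      rewrite ge0_integralZl//=; [|exact/measurable_EFinP|
        by move=> w _; rewrite lee_fin sqr_ge0|by rewrite lee_fin invr_ge0 ltW].
      rewrite ge0_integralZl//=; [|exact/measurable_EFinP|by rewrite lee_fin ltW].
      under [X in (_ + _ * X)%E]eq_integral do rewrite EFinD.
      rewrite ge0_integralD//=; [|exact: mE|exact: mE].
      rewrite rE -EFinM.
      have h1 : u^-1 * r <= u by rewrite ler_pdivrMl// -expr2.
      apply: (@le_trans _ _ (u%:E + u%:E * (K%:E + K%:E))%E).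
        rewrite leeD ?lee_fin// lee_wpmul2l ?lee_fin ?(ltW u0)// leeD//.
      by rewrite -(EFinD K K) -(EFinM u) -(EFinD u) lee_fin; lra.
    move=> h; apply: (@le_trans _ _ (`|t|%:E * (u + 2 * u * K)%:E)%E).
      by rewrite lee_wpmul2l ?lee_fin.
    rewrite -EFinM lee_fin.
    have -> : e = u * M by rewrite /u divfK// gt_eqF.
    have -> : `|t| * (u + 2 * u * K) = u * (`|t| * (1 + 2 * K)) by ring.
    by rewrite ler_pM2l// lerDl.
  have bd x y : expR (t * x) <= expR (t * y) +
      `|t| * ((x - y) ^+ 2 / u + u * (expR (2 * t * x) + expR (2 * t * y))).
    have := expR_leD (t * x) (t * y).
    rewrite -mulrBr normrM -(mulrA `|t|) => h; apply: (le_trans h).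
    rewrite lerD2l; apply: ler_wpM2l => //.
    have E2 z : expR (2 * t * z) = expR (t * z) ^+ 2.
      by rewrite -expRM_natl mulrA.
    rewrite !E2 -[(x - y) ^+ 2]real_normK ?num_real//.
    set p := `|_|; set q1 := expR _; set q2 := expR _.
    rewrite -(ler_pM2l u0).
    have -> : u * (p ^+ 2 / u + u * (q1 ^+ 2 + q2 ^+ 2)) =
        p ^+ 2 + (u * q1) ^+ 2 + (u * q2) ^+ 2 by field; rewrite gt_eqF.
    have -> : u * (p * (q1 + q2)) = p * (u * q1 + u * q2) by ring.
    have := sqr_ge0 (p - (u * q1 + u * q2)).
    have := sqr_ge0 (u * q1 - u * q2).
    have := sqr_ge0 p.
    have := sqr_ge0 (u * q1 + u * q2).
    by nra.
  have mF1 := mexp t _ mF; have mS1 := mexp t _ (mS m).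
  split; apply: le_trans (leeD2l _ intD); apply: ge0_integral_leD => // w; rewrite /D.
  by have := bd (S m w) (F w); rewrite -sqrrN opprB [expR (2 * t * S m w) + _]addrC.
have uE : (\int[P]_w (expR (t * F w))%:E)%E =
    (fine (\int[P]_w (expR (t * F w))%:E)%E)%:E.
  rewrite fineK// ge0_fin_numE; last by apply: integral_ge0.
  near \oo => m.
  have [+ _] : (\int[P]_w (expR (t * F w))%:E <=
        \int[P]_w (expR (t * S m w))%:E + 1%:E)%E /\
      (\int[P]_w (expR (t * S m w))%:E <=
        \int[P]_w (expR (t * F w))%:E + 1%:E)%E.
    by near: m; exact: close.
  by move=> /le_lt_trans; apply; rewrite Ss -EFinD ltry.
rewrite uE; congr EFin.
have <- := cvg_lim (@norm_hausdorff _ _) sl.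
apply/esym/cvg_lim; first exact: norm_hausdorff.
apply/cvgrPdist_le => e e0; near=> m.
have [] : (\int[P]_w (expR (t * F w))%:E <=
      \int[P]_w (expR (t * S m w))%:E + e%:E)%E /\
    (\int[P]_w (expR (t * S m w))%:E <=
      \int[P]_w (expR (t * F w))%:E + e%:E)%E.
  by near: m; exact: close.
rewrite uE Ss -!EFinD !lee_fin => h1 h2.
by rewrite ler_norml; apply/andP; split; lra.
Unshelve. all: by end_near. Qed.

End chaos.

(** * Derivatives of the cumulant generating function of one centred square *)

Section phi_derivatives.
Context (R : realType).
Implicit Types x y : R.

(* [phin r] is the [r]-th derivative of [phi]. *)
Definition phin (r : nat) x : R :=
  if r is r'.+1 then 2 ^+ r' * r'`!%:R * (1 - 2 * x)^-1 ^+ r - (r' == 0)%:R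
  else phi x.

(** An explicit quadratic remainder is what can later be summed over all coefficients. The induction
    rests on the exact identity [w - u = 2 h u w], and [|x| <= 1/16] keeps both inverses below
    [2]. *)
Lemma exprV_taylor r : exists M : R, forall x y, `|x| <= 16^-1 -> `|y| <= 16^-1 ->
  `|(1 - 2 * y)^-1 ^+ r - (1 - 2 * x)^-1 ^+ r -
    2 * (y - x) * r%:R * (1 - 2 * x)^-1 ^+ r.+1| <= M * (y - x) ^+ 2.
Proof.
have inv_bounds z : `|z| <= 16^-1 :> R -> 0 < (1 - 2 * z)^-1 <= 2.
  rewrite ler_norml => /andP[z1 z2]; rewrite invr_gt0; apply/andP; split; first by lra.
  by rewrite -[leLHS]mul1r ler_pdivrMr; lra.
elim: r => [|r [M IHr]].
  exists 0 => x y _ _; rewrite !expr0 subrr mulr0 mul0r subr0 normr0 mul0r.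
  exact: lexx.
exists (2 * M + 4 * r.+1%:R * 2 ^+ r.+3) => x y xle yle.
have /andP[u0 u2] := inv_bounds _ xle; have /andP[w0 w2] := inv_bounds _ yle.
have x1 : 1 - 2 * x != 0 by move: u0; rewrite invr_gt0 => /gt_eqF ->.
have y1 : 1 - 2 * y != 0 by move: w0; rewrite invr_gt0 => /gt_eqF ->.
have uw : (1 - 2 * y)^-1 - (1 - 2 * x)^-1 =
    2 * (y - x) * (1 - 2 * x)^-1 * (1 - 2 * y)^-1.
  by field; apply/andP.
have := IHr x y xle yle.
set u := (1 - 2 * x)^-1 in u0 u2 uw *; set w := (1 - 2 * y)^-1 in w0 w2 uw *.
set h := y - x in uw *.
move=> IH.
have D0 : w - u - 2 * h * u * w = 0 by rewrite uw subrr.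
have -> : w ^+ r.+1 - u ^+ r.+1 - 2 * h * r.+1%:R * u ^+ r.+2 =
    w * (w ^+ r - u ^+ r - 2 * h * r%:R * u ^+ r.+1) +
    4 * r.+1%:R * (u ^+ r.+2 * w) * h ^+ 2.
  (* The two sides differ by a multiple of [w - u - 2 h u w], which vanishes. *)
  transitivity (w * (w ^+ r - u ^+ r - 2 * h * r%:R * u ^+ r.+1) +
    4 * r.+1%:R * (u ^+ r.+2 * w) * h ^+ 2 +
    (w - u - 2 * h * u * w) * (u ^+ r + 2 * h * r.+1%:R * u ^+ r.+1)).
    by rewrite -natr1 !exprS; ring.
  by rewrite D0 mul0r addr0.
apply: le_trans (ler_normD _ _) _; rewrite [leRHS]mulrDl; apply: lerD.
  by rewrite normrM gtr0_norm// -(mulrA 2 M); apply: ler_pM => //; exact: ltW.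
have uw0 : 0 <= u ^+ r.+2 * w by rewrite mulr_ge0 ?exprn_ge0// ltW.
rewrite ger0_norm; last by rewrite mulr_ge0 ?sqr_ge0// mulr_ge0// mulr_ge0.
rewrite ler_wpM2r ?sqr_ge0// ler_wpM2l ?mulr_ge0//.
rewrite [leRHS]exprSr; apply: ler_pM => //; rewrite ?exprn_ge0 ?(ltW u0) ?(ltW w0)//.
by rewrite lerXn2r ?nnegrE ?(ltW u0).
Qed.

Lemma phin_taylor r : exists M : R, forall x y, `|x| <= 16^-1 -> `|y| <= 16^-1 ->
  `|phin r y - phin r x - (y - x) * phin r.+1 x| <= M * (y - x) ^+ 2.
Proof.
case: r => [|r].
  exists 16 => x y; rewrite (ler_norml x) (ler_norml y) => /andP[x1 x2] /andP[y1 y2].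
  have x0 : 0 < 1 - 2 * x by lra.
  have y0 : 0 < 1 - 2 * y by lra.
  pose u := (1 - 2 * x)^-1.
  have u0 : 0 < u by rewrite invr_gt0.
  have u2 : u <= 2 by rewrite /u -[leLHS]mul1r ler_pdivrMr; lra.
  have hu : (y - x) * u <= 4^-1 by rewrite ler_pdivrMr; lra.
  (* The second-order remainder of [phi] is again a value of [phi]. *)
  have -> : phin 0 y - phin 0 x - (y - x) * phin 1 x = phi ((y - x) * u).
    have -> : phin 1 x = u - 1 by rewrite /phin expr0 fact0 !mul1r expr1.
    rewrite /phin /phi.
    have -> : 1 - 2 * ((y - x) * u) = (1 - 2 * y) * u.
      by rewrite /u; field; rewrite gt_eqF.
    rewrite lnM ?posrE// lnV ?posrE//.
    by field.
  rewrite ger0_norm; last by apply: phi_ge0; lra.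
  apply: le_trans (phi_le hu) _.
  rewrite exprMn mulrCA mulrC ler_wpM2r ?sqr_ge0//.
  have : u ^+ 2 <= 2 ^+ 2 by rewrite lerXn2r ?nnegrE ?(ltW u0).
  by lra.
have [M HM] := exprV_taylor r.+1.
pose c : R := 2 ^+ r * r`!%:R.
have c0 : 0 <= c by rewrite mulr_ge0 ?exprn_ge0.
exists (c * M) => x y xle yle.
rewrite -mulrA; apply: le_trans (ler_wpM2l c0 (HM x y xle yle)).
rewrite -[X in X * `|_|]ger0_norm// -normrM le_eqVlt; apply/orP; left; apply/eqP.
have cS : 2 ^+ r.+1 * (r.+1)`!%:R = 2 * r.+1%:R * c :> R.
  by rewrite factS natrM exprS /c; ring.
congr `|_|; rewrite /phin cS -/c /= subr0.
by ring.
Qed.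

Lemma phin0 r : (2 <= r)%N -> phin r 0 = 2 ^+ r.-1 * (r.-1)`!%:R.
Proof.
by case: r => [|[|r]]// _; rewrite /phin/= mulr0 !subr0 invr1 expr1n mulr1.
Qed.

Lemma phin00 : phin 0 0 = 0.
Proof. by rewrite /phin /phi mulr0 subr0 ln1 mul0r subr0 oppr0. Qed.

Lemma phin10 : phin 1 0 = 0.
Proof. by rewrite /phin mulr0 subr0 invr1 expr1n expr0 fact0 !mulr1 subrr. Qed.

End phi_derivatives.

(** Turns a quadratic remainder into the limit of difference quotients by which [derive1] is
    defined. *)
Lemma derive1_quadratic (R : realType) (f : R -> R) (a l K e : R) : 0 < e ->
  (forall h, `|h| < e -> `|f (h + a) - f a - h * l| <= K * h ^+ 2) ->
  derive1 f a = l.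
Proof.
move=> e0 fl; rewrite /derive1; apply/cvg_lim; first exact: norm_hausdorff.
apply/cvgrPdist_le => u u0.
have K1 : 0 < `|K| + 1 by rewrite ltr_wpDl.
near=> h.
have h0 : h != 0 by near: h; exact: nbhs_dnbhs_neq.
have he : `|h| < e by near: h; exact: dnbhs0_lt.
have hu : `|h| < u / (`|K| + 1) by near: h; apply: dnbhs0_lt; rewrite divr_gt0.
rewrite -normrN opprB.
have -> : h^-1 *: (f (h + a) - f a) - l = h^-1 * (f (h + a) - f a - h * l).
  by rewrite [RHS]mulrBr mulKf.
rewrite normrM normfV ler_pdivrMl ?normr_gt0//.
apply: le_trans (fl h he) _.
rewrite -[h ^+ 2]real_normK ?num_real// expr2 mulrCA ler_wpM2l//.
rewrite ltr_pdivlMr// in hu.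
apply: le_trans (ltW hu); rewrite mulrC ler_wpM2l//.
by rewrite (le_trans (ler_norm K))// lerDl.
Unshelve. all: by end_near. Qed.

(** * Termwise differentiation of the series *)

Section dominated_series.
Context (R : realType) (a : nat -> R) (B : R).
Hypothesis aB : forall m, \sum_(k < m) a k ^+ 2 <= B.

Lemma dominated_series_cvg (u : nat -> R) (C : R) :
  (forall k, `|u k| <= C * a k ^+ 2) -> cvgn (fun m => \sum_(k < m) u k).
Proof.
move=> uC; have C0 : forall k, 0 <= C * a k ^+ 2.
  by move=> k; exact: le_trans (normr_ge0 _) (uC k).
have -> : (fun m => \sum_(k < m) u k) = series u.
  by apply/funext => m; rewrite /series/= big_mkord.
apply: normed_cvg.
change (cvgn (series (fun k => `|u k|))).
apply: nondecreasing_is_cvgn.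
  by apply/nondecreasing_seqP => n; rewrite /series/= big_nat_recr//= lerDl.
exists (`|C| * B) => _ [m _ <-]; rewrite /series/= big_mkord.
apply: (@le_trans _ _ (\sum_(k < m) `|C| * a k ^+ 2)).
  apply: ler_sum => k _; apply: le_trans (uC k) _.
  by rewrite ler_wpM2r ?sqr_ge0// ler_norm.
by rewrite -mulr_sumr ler_wpM2l.
Qed.

Variable A : R.
Hypotheses (A0 : 0 < A) (aA : forall k, `|a k| <= A).

(** Within this radius every [a k * t] stays in the interval where [phin_taylor] applies. *)
Let t0 : R := (16 * A)^-1.

Let t0_gt0 : 0 < t0. Proof. by rewrite invr_gt0 mulr_gt0. Qed.

Let small k t : `|t| < t0 -> `|a k * t| <= 16^-1.
Proof.
move=> /ltW tt0; rewrite normrM.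
have -> : 16^-1 = A * t0 by rewrite /t0; field; rewrite gt_eqF.
by rewrite ler_pM.
Qed.

Let small0 : `|0 : R| <= 16^-1. Proof. by rewrite normr0. Qed.

(** Each term needs two factors [a k] to be summable: [phin 0] vanishes to second order at [0];
    [phin 1] vanishes to first order and has one factor outside; from [r = 2] on, both come from
    [a k ^+ r] while [phin r] stays bounded. *)
Lemma phin_dominated r t : `|t| < t0 ->
  exists C, forall k, `|a k ^+ r * phin r (a k * t)| <= C * a k ^+ 2.
Proof.
move=> tt0; have [M HM] := phin_taylor R r.
case: r HM => [|[|r]] HM.
- exists (M * t ^+ 2) => k; rewrite expr0 mul1r.
  have := HM 0 _ small0 (small k tt0).
  rewrite phin00 phin10 !subr0 mulr0 subr0 => h; apply: le_trans h _.
  by rewrite exprMn; lra.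
- exists (`|t| * (`|phin 2 (0 : R)| + `|M|)) => k; rewrite expr1 normrM.
  have sk := small k tt0.
  have := HM 0 _ small0 sk; rewrite phin10 !subr0 => h.
  set y := a k * t in h sk *.
  have h1 : `|phin 1 y| <= `|y| * (`|phin 2 (0 : R)| + `|M|).
    have -> : phin 1 y = (phin 1 y - y * phin 2 0) + y * phin 2 0 by lra.
    apply: le_trans (ler_normD _ _) _; rewrite normrM [leRHS]mulrDr [leRHS]addrC lerD2r.
    apply: le_trans h _; rewrite -[y ^+ 2]real_normK ?num_real// expr2 mulrCA.
    rewrite ler_wpM2l//; apply: (@le_trans _ _ (`|M| * `|y|)).
      by rewrite ler_wpM2r// ler_norm.
    by rewrite ler_piMr//; apply: le_trans sk _; lra.
  apply: le_trans (ler_wpM2l (normr_ge0 (a k)) h1) _.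
  rewrite /y normrM -[a k ^+ 2]real_normK ?num_real//.
  by rewrite le_eqVlt; apply/orP; left; apply/eqP; ring.
- exists (A ^+ r * (`|phin r.+2 (0 : R)| + `|phin r.+3 (0 : R)| + `|M|)) => k.
  have sk := small k tt0.
  have := HM 0 _ small0 sk; rewrite !subr0 => h.
  set y := a k * t in h sk *.
  have y1 : `|y| <= 1 by apply: le_trans sk _; lra.
  have h1 : `|phin r.+2 y| <= `|phin r.+2 (0 : R)| + `|phin r.+3 (0 : R)| + `|M|.
    have -> : phin r.+2 y = phin r.+2 0 + y * phin r.+3 0 +
      (phin r.+2 y - phin r.+2 0 - y * phin r.+3 0) by lra.
    apply: le_trans (ler_normD _ _) _; apply: lerD.
      apply: le_trans (ler_normD _ _) _; rewrite lerD2l normrM.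
      by rewrite ler_piMl.
    apply: le_trans h _; rewrite -[y ^+ 2]real_normK ?num_real//.
    apply: (@le_trans _ _ (`|M| * `|y| ^+ 2)).
      by rewrite ler_wpM2r ?exprn_ge0// ler_norm.
    by rewrite ler_piMr// exprn_ile1.
  have h2 : `|a k| ^+ r * `|phin r.+2 y| <=
      A ^+ r * (`|phin r.+2 (0 : R)| + `|phin r.+3 (0 : R)| + `|M|).
    apply: ler_pM => //.
    by rewrite lerXn2r ?nnegrE// ltW.
  have -> : `|a k ^+ r.+2 * phin r.+2 y| = `|a k| ^+ r * `|phin r.+2 y| * a k ^+ 2.
    rewrite normrM normrX -[a k ^+ 2]real_normK ?num_real// -addn2 exprD.
    by rewrite mulrAC.
  by rewrite ler_wpM2r// sqr_ge0.
Qed.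

Definition phin_series r t :=
  lim ((\sum_(k < m) a k ^+ r * phin r (a k * t)) @[m --> \oo]).

Lemma phin_series_cvg r t : `|t| < t0 ->
  \sum_(k < m) a k ^+ r * phin r (a k * t) @[m --> \oo] --> phin_series r t.
Proof. by move=> /(phin_dominated r)[C /dominated_series_cvg]. Qed.

(** The remainder of the [k]-th term carries a factor [a k ^+ 2], so the partial sums share one
    constant, which survives in the limit. *)
Lemma phin_series_taylor r : exists K, forall s t, `|s| < t0 -> `|t| < t0 ->
  `|phin_series r s - phin_series r t - (s - t) * phin_series r.+1 t| <=
    K * (s - t) ^+ 2.
Proof.
have [M HM] := phin_taylor R r.
exists (`|M| * A ^+ r * B) => s t ss tt.
apply: (@cvgr_to_le _ \oo _ _ (fun m => `|\sum_(k < m) a k ^+ r * phin r (a k * s) -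
   \sum_(k < m) a k ^+ r * phin r (a k * t) -
   (s - t) * \sum_(k < m) a k ^+ r.+1 * phin r.+1 (a k * t)|)).
  apply: cvg_norm; apply: cvgB.
    by apply: cvgB; exact: phin_series_cvg.
  by apply: cvgM; [exact: cvg_cst|exact: phin_series_cvg].
near=> m; rewrite mulr_sumr -!sumrB.
apply: le_trans (ler_norm_sum _ _ _) _.
apply: (@le_trans _ _ (\sum_(k < m) `|M| * A ^+ r * (s - t) ^+ 2 * a k ^+ 2)).
  apply: ler_sum => k _.
  have -> : a k ^+ r * phin r (a k * s) - a k ^+ r * phin r (a k * t) -
      (s - t) * (a k ^+ r.+1 * phin r.+1 (a k * t)) =
      a k ^+ r * (phin r (a k * s) - phin r (a k * t) -
        (a k * s - a k * t) * phin r.+1 (a k * t)).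
    by rewrite exprS; ring.
  rewrite normrM normrX.
  apply: (@le_trans _ _ (A ^+ r * (`|M| * (a k * s - a k * t) ^+ 2))).
    apply: ler_pM => //.
      by rewrite lerXn2r ?nnegrE// ltW.
    apply: le_trans (HM _ _ (small k tt) (small k ss)) _.
    by rewrite ler_wpM2r ?sqr_ge0// ler_norm.
  by rewrite le_eqVlt; apply/orP; left; apply/eqP; ring.
rewrite -mulr_sumr.
have -> : `|M| * A ^+ r * B * (s - t) ^+ 2 = `|M| * A ^+ r * (s - t) ^+ 2 * B by ring.
by rewrite ler_wpM2l// mulr_ge0 ?sqr_ge0// mulr_ge0// exprn_ge0// ltW.
Unshelve. all: by end_near. Qed.

Lemma derive1n_phin_series (f : R -> R) :
  (forall t, `|t| < t0 -> f t = phin_series 0 t) ->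
  forall r t, `|t| < t0 -> derive1n r f t = phin_series r t.
Proof.
move=> f0; elim=> [|r IHr] t tt; first exact: f0.
rewrite derive1nS; have [K HK] := phin_series_taylor r.
(* The induction hypothesis holds only inside the radius [t0]; [t0 - |t|] is the room left around
   [t]. *)
apply: (@derive1_quadratic _ _ _ _ K (t0 - `|t|)); first by rewrite subr_gt0.
move=> h; rewrite ltrBrDr => ht.
have htt : `|h + t| < t0 by exact: le_lt_trans (ler_normD _ _) ht.
by rewrite !IHr//; have := HK _ _ htt tt; rewrite addrK.
Qed.

Lemma derive1n_phin_series0 (f : R -> R) (r : nat) (p : R) : (2 <= r)%N ->
  (forall t, `|t| < t0 -> f t = phin_series 0 t) ->
  \sum_(k < m) a k ^+ r @[m --> \oo] --> p ->
  derive1n r f 0 = phin r 0 * p.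
Proof.
move=> r2 f0 ap; rewrite (derive1n_phin_series f0) ?normr0//.
apply/cvg_lim; first exact: norm_hausdorff.
under eq_fun do [under eq_bigr do rewrite mulr0; rewrite -mulr_suml mulrC].
by apply: cvgM => //; exact: cvg_cst.
Qed.

End dominated_series.

Section cumulants.
Context (R : realType) d (T : measurableType d) (P : probability T R).
Variables (N : nat -> {RV P >-> R}) (a : nat -> R) (F : {RV P >-> R}).
Hypothesis iidN : iid_standard_normal N.
Hypothesis aF : chaos_expansion N a F.
Variables (B A : R).
Hypothesis aB : forall m, \sum_(k < m) a k ^+ 2 <= B.
Hypotheses (A0 : 0 < A) (aA : forall k, `|a k| <= A).

Lemma mgf_chaos t : `|t| < (16 * A)^-1 ->
  (\int[P]_w (expR (t * F w))%:E = (expR (phin_series a 0 t))%:E)%E.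
Proof.
move=> tt.
have small k : `|t * a k| <= 16^-1.
  rewrite normrM.
  have -> : 16^-1 = (16 * A)^-1 * A by field; rewrite gt_eqF.
  by rewrite ler_pM// ltW.
(* The exponential bound at [2 t] is [phi_le] summed over the coefficients; it applies because
   [|2 t a_k| <= 1/8]. *)
apply: (@chaos_expR_cvg _ _ _ _ _ _ _ aF t (expR (4 * (2 * t) ^+ 2 * B)) _
  (fun m => expR (\sum_(k < m) phi (t * a k)))).
- move=> m; rewrite integral_expR_chi2_sum//; last first.
    move=> k _; have := small k; rewrite ler_norml => /andP[_].
    by rewrite -mulrA; lra.
  rewrite lee_fin ler_expR.
  apply: (@le_trans _ _ (\sum_(k < m) 4 * (2 * t) ^+ 2 * a k ^+ 2)).
    apply: ler_sum => k _; rewrite -(mulrA 4) -(exprMn _ (2 * t)); apply: phi_le.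
    by have := small k; rewrite ler_norml => /andP[_]; rewrite -mulrA; lra.
  by rewrite -mulr_sumr ler_wpM2l// mulr_ge0// sqr_ge0.
- move=> m; rewrite integral_expR_chi2_sum// => k _.
  by have := small k; rewrite ler_norml => /andP[_]; lra.
- apply: continuous_cvg; first exact: continuous_expR.
  have := phin_series_cvg aB A0 aA (r := 0) tt.
  by under eq_fun do under eq_bigr do rewrite expr0 mul1r mulrC.
Qed.

(** Together with [phin0] this is the classical formula [kappa_r = 2^(r-1) (r-1)! sum_k a_k^r]. *)
Lemma cumulant_chaos r p : (2 <= r)%N ->
  \sum_(k < m) a k ^+ r @[m --> \oo] --> p ->
  cumulant F r = phin r 0 * p.
Proof.
move=> r2 ap; apply: (derive1n_phin_series0 aB A0 aA r2 _ ap) => t tt.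
rewrite /mmt_gen_fun unlock /=.
under eq_integral do rewrite mulrC.
by rewrite mgf_chaos//= expRK.
Qed.

End cumulants.

(** * Rigidity of the coefficients *)

Lemma finite_pos_lb (R : realType) (I : finType) (f : I -> R) :
  (forall i, 0 < f i) -> exists2 c, 0 < c & forall i, c <= f i.
Proof.
move=> f0; exists (\big[Num.min/1]_i f i).
  by elim/big_ind: _ => // x y x0 y0; rewrite lt_min x0.
by move=> i; rewrite (bigD1 i)//= ge_min lexx.
Qed.

Section coding.
Context (R : realType) (q : nat) (b : 'I_q -> R).
Implicit Types (x y : R) (r s : 'I_q).

Definition Qpoly x := x ^+ 2 * \prod_(r < q) (x - b r) ^+ 2.

Lemma Qpoly_ge0 x : 0 <= Qpoly x.
Proof. by rewrite mulr_ge0 ?sqr_ge0// prodr_ge0// => r _; rewrite sqr_ge0. Qed.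

(** The factor [2] ensures that a point within [eta] of [b r] is at distance at least [eta] from [0]
    and from every other [b s]. *)
Lemma Qpoly_separation : (forall r, b r != 0) -> injective b ->
  exists2 eta, 0 < eta & (forall r, 2 * eta <= `|b r|) /\
    (forall r s, r != s -> 2 * eta <= `|b r - b s|).
Proof.
move=> b0 b_inj.
have [c c0 cb] : exists2 c, 0 < c & forall r, c <= `|b r|.
  by apply: finite_pos_lb => r; rewrite normr_gt0.
have [e e0 eb] : exists2 e, 0 < e &
    forall z : 'I_q * 'I_q, e <= if z.1 == z.2 then 1 else `|b z.1 - b z.2|.
  apply: finite_pos_lb => -[r s]/=; case: eqVneq => // rs.
  by rewrite normr_gt0 subr_eq0; apply: contra_neq rs => /b_inj.
exists (Num.min c e / 2); first by rewrite divr_gt0// lt_min c0.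
split=> [r|r s rs]; rewrite mulrC divfK ?pnatr_eq0// ge_min ?cb//.
by have := eb (r, s); rewrite /= (negbTE rs) => ->; rewrite orbT.
Qed.

Variable eta : R.
Hypotheses (eta0 : 0 < eta) (eta_b : forall r, 2 * eta <= `|b r|)
  (eta_sep : forall r s, r != s -> 2 * eta <= `|b r - b s|).

Definition near_root x r := `|x - b r| < eta.

(* At most one [r] is near [x]: [code x] is that [b r], or [0] if there is none. *)
Definition code x := \sum_(r < q) (near_root x r)%:R * b r.

Lemma near_root_inj x r s : near_root x r -> near_root x s -> r = s.
Proof.
rewrite /near_root => xr xs; apply/eqP/negP => /negP/eta_sep.
have -> : b r - b s = (x - b s) - (x - b r) by ring.
move=> h; have := le_trans h (ler_normB _ _).
by rewrite leNgt => /negP; apply; lra.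
Qed.

Lemma far_root x r s : near_root x r -> s != r -> eta <= `|x - b s|.
Proof.
move=> xr sr; rewrite leNgt; apply/negP => xs.
by move/eqP: sr; apply; exact: near_root_inj xs xr.
Qed.

Lemma code_near x r : near_root x r -> code x = b r.
Proof.
move=> xr; rewrite /code (bigD1 r)//= xr mul1r big1 ?addr0// => s sr.
by rewrite /near_root ltNge (far_root xr sr) mul0r.
Qed.

Lemma code_far x : (forall r, ~~ near_root x r) -> code x = 0.
Proof. by move=> xr; rewrite /code big1// => r _; rewrite (negbTE (xr r)) mul0r. Qed.

Lemma codeP x : (exists2 r, near_root x r & code x = b r) \/
  ((forall r, ~~ near_root x r) /\ code x = 0).
Proof.
have [/existsP[r xr]|/existsPn xr] := boolP [exists r, near_root x r].
  by left; exists r => //; exact: code_near.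
by right; split=> //; exact: code_far.
Qed.

Lemma fun_code (f : R -> R) x : f 0 = 0 ->
  f (code x) = \sum_(r < q) (near_root x r)%:R * f (b r).
Proof.
move=> f0; have [[r xr ->]|[xr ->]] := codeP x.
  rewrite (bigD1 r)//= xr mul1r big1 ?addr0// => s sr.
  by rewrite /near_root ltNge (far_root xr sr) mul0r.
by rewrite f0 big1// => r _; rewrite (negbTE (xr r)) mul0r.
Qed.

(** Of the [q + 1] squared factors of [Qpoly], the one belonging to the selected point is the
    left-hand side, and the other [q] are at least [eta ^+ 2]. *)
Lemma code_dist x : (x - code x) ^+ 2 <= (eta ^+ 2) ^- q * Qpoly x.
Proof.
have e2 : 0 < eta ^+ 2 by rewrite exprn_gt0.
have eqn : 0 < (eta ^+ 2) ^+ q by rewrite exprn_gt0.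
rewrite ler_pdivlMl//.
have sq y : eta <= `|y| -> eta ^+ 2 <= y ^+ 2.
  by move=> h; rewrite -[leRHS]real_normK ?num_real// lerXn2r ?nnegrE// ltW.
have [[r xr ->]|[xr ->]] := codeP x; rewrite /Qpoly.
  have xe : eta <= `|x|.
    have := eta_b r; have := ler_normB x (x - b r).
    by rewrite opprB addrCA subrr addr0 => h1 h2; have := xr; rewrite /near_root; lra.
  rewrite (bigD1 r)//= [leRHS]mulrCA [leLHS]mulrC ler_wpM2l ?sqr_ge0//.
  have -> : (eta ^+ 2) ^+ q = eta ^+ 2 * \prod_(s < q | s != r) eta ^+ 2.
    have -> : (eta ^+ 2) ^+ q = \prod_(s < q) eta ^+ 2 by rewrite prodr_const card_ord.
    by rewrite (bigD1 r).
  apply: ler_pM => //; [exact: ltW|by apply: prodr_ge0 => s _; exact: ltW|exact: sq|].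
  by apply: ler_prod => s sr; rewrite ltW//= sq// (far_root xr sr).
rewrite subr0 [leLHS]mulrC ler_wpM2l ?sqr_ge0//.
have -> : (eta ^+ 2) ^+ q = \prod_(s < q) eta ^+ 2 by rewrite prodr_const card_ord.
by apply: ler_prod => s _; rewrite ltW//= sq// leNgt; exact: xr.
Qed.

Lemma code_norm x : `|code x| <= 2 * `|x|.
Proof.
have [[r xr ->]|[xr ->]] := codeP x; last by rewrite normr0 mulr_ge0.
have := eta_b r; have := ler_normB x (x - b r).
by rewrite opprB addrCA subrr addr0 => h1 h2; have := xr; rewrite /near_root; lra.
Qed.

Variables (a : nat -> R) (B D : R).
Hypotheses (aB : forall m, \sum_(k < m) a k ^+ 2 <= B)
  (aD : forall m, \sum_(k < m) Qpoly (a k) <= D).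

Definition count_near m r := (\sum_(k < m) near_root (a k) r)%N.

Lemma sum_code_dist m : \sum_(k < m) (a k - code (a k)) ^+ 2 <= (eta ^+ 2) ^- q * D.
Proof.
apply: (@le_trans _ _ ((eta ^+ 2) ^- q * \sum_(k < m) Qpoly (a k))).
  by rewrite mulr_sumr; apply: ler_sum => k _; exact: code_dist.
by rewrite ler_wpM2l// invr_ge0 exprn_ge0// sqr_ge0.
Qed.

Lemma sum_fun_code (f : R -> R) m : f 0 = 0 ->
  \sum_(k < m) f (code (a k)) = \sum_(r < q) (count_near m r)%:R * f (b r).
Proof.
move=> f0; under eq_bigr do rewrite fun_code//.
rewrite exchange_big/=; apply: eq_bigr => r _.
by rewrite -mulr_suml /count_near natr_sum.
Qed.

Lemma count_near_le m r : (count_near m r)%:R <= B / eta ^+ 2.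
Proof.
rewrite ler_pdivlMr ?exprn_gt0//; apply: le_trans (aB m).
rewrite /count_near natr_sum mulr_suml; apply: ler_sum => k _.
have [xr|_] := boolP (near_root (a k) r); last by rewrite mul0r sqr_ge0.
have xe : eta <= `|a k|.
  have := eta_b r; have := ler_normB (a k) (a k - b r).
  by rewrite opprB addrCA subrr addr0 => h1 h2; have := xr; rewrite /near_root; lra.
rewrite mul1r -[leRHS]real_normK ?num_real// lerXn2r ?nnegrE//; exact: ltW.
Qed.

(** The weight [|x| + |y|] makes the errors products of two square-summable sequences, which [e]
    separates: [D] bounds the rounding errors and [B] the coefficients. The [3] comes from
    [|code x| <= 2 |x|]. *)
Lemma sum_code_close (f : R -> R) (K e : R) m : 0 <= K -> 0 < e -> f 0 = 0 ->
  (forall k, `|f (a k) - f (code (a k))| <=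
     K * (`|a k - code (a k)| * (`|a k| + `|code (a k)|))) ->
  `|\sum_(k < m) f (a k) - \sum_(r < q) (count_near m r)%:R * f (b r)| <=
  3 * K * ((eta ^+ 2) ^- q * D / e + e * B).
Proof.
move=> K0 e0 f0 fK; rewrite -sum_fun_code// -sumrB.
apply: le_trans (ler_norm_sum _ _ _) _.
apply: (@le_trans _ _ (\sum_(k < m) 3 * K * ((a k - code (a k)) ^+ 2 / e + e * a k ^+ 2))).
  apply: ler_sum => k _; apply: le_trans (fK k) _.
  rewrite [3 * K]mulrC -(mulrA K); apply: ler_wpM2l => //.
  set u := a k - code (a k).
  have h1 : `|u| * (`|a k| + `|code (a k)|) <= 3 * (`|u| * `|a k|).
    by rewrite mulrCA ler_wpM2l//; have := code_norm (a k); lra.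
  have h2 : `|u| * `|a k| <= u ^+ 2 / e + e * a k ^+ 2.
    rewrite -[u ^+ 2]real_normK ?num_real// -[a k ^+ 2]real_normK ?num_real//.
    rewrite -(ler_pM2l e0).
    have -> : e * (`|u| ^+ 2 / e + e * `|a k| ^+ 2) = `|u| ^+ 2 + (e * `|a k|) ^+ 2.
      by field; rewrite gt_eqF.
    have := sqr_ge0 (`|u| - e * `|a k|).
    have := sqr_ge0 (`|u|).
    have := sqr_ge0 (e * `|a k|).
    by nra.
  by lra.
rewrite -mulr_sumr ler_wpM2l ?mulr_ge0// big_split/= -mulr_suml -mulr_sumr.
apply: lerD; first by rewrite ler_pM2r ?invr_gt0// sum_code_dist.
by rewrite ler_pM2l//; exact: aB.
Qed.

(** As the counts equal [1] for all large [m], exactly one index in the whole sequence is near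
    [b r]; it is [tau r]. *)
Lemma count_near_one (m0 : nat) :
  (forall m, (m0 <= m)%N -> forall r, count_near m r = 1%N) ->
  exists2 tau : 'I_q -> nat, injective tau &
    forall k, code (a k) = \sum_(r < q) (tau r == k)%:R * b r.
Proof.
move=> c1.
have ex r : exists k, near_root (a k) r.
  apply: contrapT => /forallNP nex; have := c1 m0 (leqnn _) r.
  rewrite /count_near big1// => k _; apply/eqP; rewrite eqb0; apply/negP; exact: nex.
have uniq r j k : near_root (a j) r -> near_root (a k) r -> j = k.
  wlog jk : j k / (j <= k)%N.
    move=> h; have [jk|/ltnW kj] := leqP j k; first exact: h.
    by move=> nj nk; apply/esym/h.
  move=> nj nk; apply/eqP; rewrite eqn_leq jk/= leqNgt; apply/negP => jk'.
  have := c1 (maxn m0 k.+1) (leq_maxl _ _) r.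
  have km : (k < maxn m0 k.+1)%N by rewrite leq_max ltnSn orbT.
  have jm := ltn_trans jk' km.
  rewrite /count_near (bigD1 (Ordinal km))//= nk (bigD1 (Ordinal jm))/=; last first.
    by rewrite -val_eqE/= ltn_eqF.
  by rewrite nj.
exists (fun r => sval (cid (ex r))).
  move=> r s /= rs.
  have := svalP (cid (ex r)); have := svalP (cid (ex s)); rewrite rs => h1 h2.
  exact: near_root_inj h2 h1.
move=> k; apply: eq_bigr => r _; congr (_%:R * _); congr nat_of_bool.
apply/idP/eqP => [nk|<-]; last exact: svalP (cid (ex r)).
exact: uniq (svalP (cid (ex r))) nk.
Qed.

End coding.

(** * Polynomials divisible by [x^2] *)

Section interpolation.
Context (R : realType).
Implicit Types x y : R.

(** Exponents of at least [2] are what yields the factor [|x| + |y|] that [sum_code_close]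
    requires. *)
Lemma exprn_lip (A : R) j : 0 <= A -> exists2 K, 0 <= K &
  forall x y, `|x| <= A -> `|y| <= A ->
    `|x ^+ j.+2 - y ^+ j.+2| <= K * (`|x - y| * (`|x| + `|y|)).
Proof.
move=> A0; elim: j => [|j [K K0 IHj]].
  exists 1 => // x y _ _; rewrite mul1r subr_sqr normrM ler_wpM2l//.
  exact: ler_normD.
exists (A * K + A ^+ j.+1); first by rewrite addr_ge0 ?mulr_ge0 ?exprn_ge0.
move=> x y xA yA.
have -> : x ^+ j.+3 - y ^+ j.+3 = x * (x ^+ j.+2 - y ^+ j.+2) + (x - y) * y * y ^+ j.+1.
  by rewrite !exprS; ring.
apply: le_trans (ler_normD _ _) _; rewrite [leRHS]mulrDl; apply: lerD.
  by rewrite normrM -mulrA; apply: ler_pM => //; exact: IHj.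
rewrite !normrM normrX [leRHS]mulrC; apply: ler_pM => //.
- by rewrite ler_wpM2l// lerDr.
- by rewrite lerXn2r ?nnegrE.
Qed.

Lemma sum_exprn_lip (A : R) q (w : 'I_q -> R) : 0 <= A -> exists2 K, 0 <= K &
  forall x y, `|x| <= A -> `|y| <= A ->
    `|\sum_(j < q) w j * x ^+ j.+2 - \sum_(j < q) w j * y ^+ j.+2| <=
    K * (`|x - y| * (`|x| + `|y|)).
Proof.
move=> A0.
have /choice[K HK] (j : 'I_q) : exists K, 0 <= K /\
  forall x y, `|x| <= A -> `|y| <= A ->
    `|x ^+ j.+2 - y ^+ j.+2| <= K * (`|x - y| * (`|x| + `|y|)).
  by have [K K0 HK] := exprn_lip j A0; exists K.
exists (\sum_(j < q) `|w j| * K j).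
  by apply: sumr_ge0 => j _; rewrite mulr_ge0//; exact: (HK j).1.
move=> x y xA yA; rewrite -sumrB; apply: le_trans (ler_norm_sum _ _ _) _.
rewrite mulr_suml; apply: ler_sum => j _; rewrite -mulrBr normrM -mulrA.
by rewrite ler_wpM2l//; exact: (HK j).2.
Qed.

(* Lagrange interpolation at the [b s] with the polynomials [X^2 * p], where
   [p] has degree less than [q]. *)
Lemma lagrange_weights q (b : 'I_q -> R) : (forall r, b r != 0) -> injective b ->
  exists w : 'I_q -> 'I_q -> R, forall r s,
    \sum_(j < q) w r j * b s ^+ j.+2 = (r == s)%:R.
Proof.
move=> b0 b_inj.
pose p r : {poly R} := \prod_(s < q | s != r) ('X - (b s)%:P).
have pE r x : (p r).[x] = \prod_(s < q | s != r) (x - b s).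
  by rewrite /p horner_prod; apply: eq_bigr => s _; rewrite hornerXsubC.
have size_p r : (size (p r) <= q)%N.
  rewrite /p -big_filter; have [e _ _ [_ size_e]] := big_enumP (predC1 r).
  rewrite size_prod_XsubC size_e.
  by rewrite (cardC1 r) card_ord (ltn_predK (ltn_ord r)).
have pb0 r : (p r).[b r] != 0.
  rewrite pE; apply/prodf_neq0 => s sr; rewrite subr_eq0.
  by apply: contra_neq sr => /b_inj.
exists (fun r j => (p r)`_j / (b r ^+ 2 * (p r).[b r])) => r s.
transitivity ((p r).[b s] * (b s ^+ 2 / (b r ^+ 2 * (p r).[b r]))).
  rewrite (horner_coef_wide (b s) (size_p r)) mulr_suml; apply: eq_bigr => j _.
  by rewrite !exprS; set c := (_ * _.[_])^-1; ring.
have [<-|rs] := eqVneq r s.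
  by rewrite invfM mulVKf ?sqrf_eq0// divff.
by rewrite pE (bigD1 s) 1?eq_sym//= subrr !mul0r.
Qed.

Lemma near1_nat (n : nat) : `|n%:R - 1| < 1 :> R -> n = 1%N.
Proof.
rewrite ltr_norml => /andP[n0 n2].
have : (0 < n%:R :> R) by lra.
have : (n%:R < 2 :> R) by lra.
by rewrite ltr_nat ltr0n; case: n {n0 n2} => [|[]].
Qed.

End interpolation.

Section rigidity.
Context (R : realType) (q : nat) (b : 'I_q -> R).
Hypotheses (b0 : forall r, b r != 0) (b_inj : injective b).

(* Coefficients of the target once its [r]-th variable is moved to index [tau r]. *)
Definition placed (tau : 'I_q -> nat) (k : nat) : R :=
  \sum_(r < q) (tau r == k)%:R * b r.

(** [e] is dictated by the term [e * B], and [delta] by [E * D / e] for that [e]; each term is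
    allotted half of [u]. The shifts [K + 1] and [B + 1] keep the denominators positive. *)
Lemma small_parameters (K E B u : R) : 0 <= K -> 0 < E -> 0 <= B -> 0 < u ->
  exists2 e, 0 < e & exists2 delta, 0 < delta &
    forall D, D <= delta -> 3 * K * (E * D / e + e * B) <= u.
Proof.
move=> K0 E0 B0 u0.
pose e := u / (6 * (K + 1) * (B + 1)).
have den : 0 < 6 * (K + 1) * (B + 1) by rewrite mulr_gt0 ?mulr_gt0//; lra.
have e0 : 0 < e by rewrite divr_gt0.
pose delta := e * u / (6 * (K + 1) * E).
have den' : 0 < 6 * (K + 1) * E by rewrite mulr_gt0 ?mulr_gt0//; lra.
exists e => //; exists delta; first by rewrite divr_gt0// mulr_gt0.
move=> D Dd.
have h1 : 6 * (K + 1) * (e * B) <= u.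
  have -> : u = e * (6 * (K + 1) * (B + 1)) by rewrite /e divfK// gt_eqF.
  have -> : 6 * (K + 1) * (e * B) = e * (6 * (K + 1) * B) by ring.
  by rewrite ler_pM2l// ler_pM2l; lra.
have h2 : 6 * (K + 1) * (E * D / e) <= u.
  apply: (@le_trans _ _ (6 * (K + 1) * (E * delta / e))).
    rewrite ler_pM2l; last by lra.
    by rewrite ler_pM2r ?invr_gt0// ler_pM2l.
  have -> : 6 * (K + 1) * (E * delta / e) = u.
    by rewrite /delta; field; rewrite !gt_eqF//; lra.
  by [].
have h3 : 0 <= e * B by rewrite mulr_ge0// ltW.
have [h4|h4] := leP 0 (E * D / e); first by nra.
apply: (@le_trans _ _ (3 * K * (e * B))); last by nra.
by rewrite ler_wpM2l; [|rewrite mulr_ge0|]; lra.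
Qed.

Local Notation P j := (\sum_(r < q) b r ^+ j).

Lemma P2_ge0 : 0 <= P 2. Proof. by apply: sumr_ge0 => r _; rewrite sqr_ge0. Qed.

Lemma partial_sum_le (a : nat -> R) l : \sum_(k < m) a k ^+ 2 @[m --> \oo] --> l ->
  forall m, \sum_(k < m) a k ^+ 2 <= l.
Proof.
move=> al m; have <- := cvg_lim (@norm_hausdorff _ _) al.
apply: nondecreasing_cvgn_le; last by apply/cvg_ex; exists l.
by apply/nondecreasing_seqP => n; rewrite big_ord_recr/= lerDl sqr_ge0.
Qed.

Lemma norm_le_sum_sqr (a : nat -> R) (B : R) :
  (forall m, \sum_(k < m) a k ^+ 2 <= B) -> forall k, `|a k| <= 1 + B.
Proof.
move=> aB k; have : a k ^+ 2 <= B.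
  apply: le_trans (aB k.+1); rewrite big_ord_recr/= lerDr.
  by apply: sumr_ge0 => j _; rewrite sqr_ge0.
rewrite -[a k ^+ 2]real_normK ?num_real//.
by have := sqr_ge0 (`|a k| - 1); have := normr_ge0 (a k); nra.
Qed.

(** The part common to both criteria, which differ only in how they show that all multiplicities are
    [1]. The range [2 * (1 + P 2)] contains each coefficient, bounded by [1 + P 2], and its
    rounding, at most twice as large. *)
Lemma rigidity_core : exists2 C, 0 < C & exists2 eta, 0 < eta &
  (forall r, 2 * eta <= `|b r|) /\
  forall (a : nat -> R) D,
    \sum_(k < m) a k ^+ 2 @[m --> \oo] --> P 2 ->
    (forall m, \sum_(k < m) Qpoly b (a k) <= D) ->
    (forall (f : R -> R) K e m, 0 <= K -> 0 < e -> f 0 = 0 ->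
      (forall x y, `|x| <= 2 * (1 + P 2) -> `|y| <= 2 * (1 + P 2) ->
         `|f x - f y| <= K * (`|x - y| * (`|x| + `|y|))) ->
      `|\sum_(k < m) f (a k) - \sum_(r < q) (count_near b eta a m r)%:R * f (b r)| <=
        3 * K * (C * D / e + e * P 2)) /\
    ((exists m0, forall m, (m0 <= m)%N -> forall r, count_near b eta a m r = 1%N) ->
      exists2 tau, injective tau &
        forall m, \sum_(k < m) (a k - placed tau k) ^+ 2 <= C * D).
Proof.
have [eta eta0 [eta_b eta_sep]] := Qpoly_separation b0 b_inj.
exists ((eta ^+ 2) ^- q); first by rewrite invr_gt0 !exprn_gt0.
exists eta => //; split=> // a D aP aD.
have aB := partial_sum_le aP; have B0 := P2_ge0.
split.
  move=> f K e m K0 e0 f0 fK; apply: sum_code_close => // k.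
  have ak := norm_le_sum_sqr aB k.
  apply: fK; first by lra.
  by apply: le_trans (code_norm eta_b eta_sep (a k)) _; rewrite ler_pM2l.
move=> [m0 c1]; have [tau tau_inj tauE] := count_near_one eta_sep c1.
exists tau => // m; rewrite /placed.
under eq_bigr do rewrite -tauE.
exact: sum_code_dist.
Qed.

Lemma rigidity_cumulants : exists2 C, 0 < C & exists2 delta, 0 < delta &
  forall (a : nat -> R) (p : nat -> R) D,
    \sum_(k < m) a k ^+ 2 @[m --> \oo] --> P 2 ->
    (forall m, \sum_(k < m) Qpoly b (a k) <= D) ->
    (forall j, (2 <= j < q.+2)%N -> \sum_(k < m) a k ^+ j @[m --> \oo] --> p j) ->
    D <= delta -> \sum_(2 <= j < q.+2) `|p j - P j| <= delta ->
    exists2 tau, injective tau &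
      forall m, \sum_(k < m) (a k - placed tau k) ^+ 2 <= C * D.
Proof.
have [C C0 [eta eta0 [eta_b core]]] := rigidity_core.
have [w wE] := lagrange_weights b0 b_inj.
have A0 : 0 <= 2 * (1 + P 2) by have := P2_ge0; lra.
pose f r x := \sum_(j < q) w r j * x ^+ j.+2.
have /choice[K HK] (r : 'I_q) : exists K, 0 <= K /\
    forall x y, `|x| <= 2 * (1 + P 2) -> `|y| <= 2 * (1 + P 2) ->
    `|f r x - f r y| <= K * (`|x - y| * (`|x| + `|y|)).
  by have [K K0 HK] := sum_exprn_lip (w r) A0; exists K.
(* [W] exceeds every [|w r j|], so closeness of the power sums passes to the interpolating
   polynomials. *)
pose W := 1 + \sum_(r < q) \sum_(j < q) `|w r j|.
have W0 : 0 < W.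
  by rewrite ltr_pwDl// sumr_ge0// => r _; rewrite sumr_ge0.
have /choice[ed Hed] (r : 'I_q) : exists ed : R * R, [/\ 0 < ed.1, 0 < ed.2 &
    forall D, D <= ed.2 -> 3 * K r * (C * D / ed.1 + ed.1 * P 2) <= 4^-1].
  have [|e e0 [dl d0 H]] := @small_parameters (K r) C (P 2) 4^-1 (HK r).1 C0 P2_ge0.
    by rewrite invr_gt0.
  by exists (e, dl).
have [dl d0 dlE] : exists2 c, 0 < c & forall r, c <= (ed r).2.
  by apply: finite_pos_lb => r; have [] := Hed r.
exists C => //; exists (Num.min dl (4 * W)^-1).
  by rewrite lt_min d0 invr_gt0 mulr_gt0.
move=> a p D aP aD ap; rewrite le_min => /andP[Ddl _] kap.
have [close] := core a D aP aD; apply.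
have kapW : W * \sum_(2 <= j < q.+2) `|p j - P j| <= 4^-1.
  have -> : 4^-1 = W * (4 * W)^-1 by field; rewrite gt_eqF.
  by rewrite ler_pM2l//; apply: le_trans kap _; rewrite ge_min lexx orbT.
have fcvg r : \sum_(k < m) f r (a k) @[m --> \oo] --> \sum_(j < q) w r j * p j.+2.
  rewrite /f; under eq_fun do rewrite exchange_big/=.
  apply: cvg_big => [|j _]; first exact: add_continuous.
  under eq_fun do rewrite -mulr_sumr.
  apply: cvgM; first exact: cvg_cst.
  by apply: ap; rewrite !ltnS ltn_ord.
have near_m : \forall m \near \oo, forall r, count_near b eta a m r = 1%N.
  apply: filter_forall => r.
  (* Three errors separate the count from [1]: [1/8] for truncating the series, [1/4] for rounding
     and [1/4] for the power sums. Their total is below [1], which determines the integer. *)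
  have e8 : 0 < 8^-1 :> R by rewrite invr_gt0.
  have /cvgrPdist_le/(_ _ e8) := fcvg r.
  apply: filterS => m h; apply: (@near1_nat R).
  have [e0 _ /(_ D (le_trans Ddl (dlE r))) h1] := Hed r.
  have fr0 : f r 0 = 0 by rewrite /f big1// => j _; rewrite exprS mul0r mulr0.
  have h2 := close (f r) (K r) (ed r).1 m (HK r).1 e0 fr0 (HK r).2.
  have cE : \sum_(s < q) (count_near b eta a m s)%:R * f r (b s) =
      (count_near b eta a m r)%:R.
    rewrite (bigD1 r)//= {1}/f wE eqxx mulr1 big1 ?addr0// => s sr.
    by rewrite /f wE eq_sym (negbTE sr) mulr0.
  rewrite cE in h2.
  have h3 : `|\sum_(j < q) w r j * p j.+2 - 1| <= 4^-1.
    have -> : \sum_(j < q) w r j * p j.+2 - 1 =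
        \sum_(j < q) w r j * (p j.+2 - P j.+2).
      under [RHS]eq_bigr do rewrite mulrBr mulr_sumr.
      rewrite sumrB exchange_big/=; congr (_ - _).
      rewrite (bigD1 r)//= wE eqxx big1 ?addr0// => s sr.
      by rewrite wE eq_sym (negbTE sr).
    apply: le_trans kapW; apply: le_trans (ler_norm_sum _ _ _) _.
    have -> : \sum_(2 <= j < q.+2) `|p j - P j| = \sum_(j < q) `|p j.+2 - P j.+2|.
      by rewrite !big_add1/= big_mkord.
    rewrite mulr_sumr; apply: ler_sum => j _.
    rewrite normrM ler_wpM2r//.
    rewrite /W (bigD1 r)//= (bigD1 j)//= addrCA -!addrA lerDl.
    apply: addr_ge0; first by apply: sumr_ge0.
    by apply: addr_ge0 => //; apply: sumr_ge0 => s _; apply: sumr_ge0.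
  move: h h2 h3 h1.
  rewrite !ler_norml ltr_norml => /andP[? ?] /andP[? ?] /andP[? ?] ?.
  by apply/andP; split; lra.
have [m0 _ Hm0] := near_m.
by exists m0 => m mm0; exact: Hm0.
Qed.

Lemma rigidity_rat_free : rat_free (fun r => b r ^+ 2) ->
  exists2 C, 0 < C & exists2 delta, 0 < delta &
  forall (a : nat -> R) D,
    \sum_(k < m) a k ^+ 2 @[m --> \oo] --> P 2 ->
    (forall m, \sum_(k < m) Qpoly b (a k) <= D) ->
    D <= delta ->
    exists2 tau, injective tau &
      forall m, \sum_(k < m) (a k - placed tau k) ^+ 2 <= C * D.
Proof.
move=> free.
have [C C0 [eta eta0 [eta_b core]]] := rigidity_core.
(* By [count_near_le] every count is at most [M], so the vectors of counts range over a finite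
   type. *)
pose M := Num.truncn (P 2 / eta ^+ 2).
pose defect (n : {ffun 'I_q -> 'I_M.+1}) : R :=
  \sum_(r < q) (n r)%:R * b r ^+ 2 - P 2.
(* Finitely many non-zero defects are bounded away from [0]; the value [1] only fills in for the
   zero ones. Truncation and rounding, [gam / 4] each, then force the defect to vanish exactly. *)
have [gam g0 gamE] : exists2 c, 0 < c &
    forall n, c <= if defect n == 0 then 1 else `|defect n|.
  by apply: finite_pos_lb => n; case: eqVneq => // dn; rewrite normr_gt0.
have u0 : 0 < gam / 4 by rewrite divr_gt0.
have [e e0 [dl d0 Hdl]] := small_parameters ler01 C0 P2_ge0 u0.
exists C => //; exists dl => // a D aP aD Ddl.
have [close] := core a D aP aD; apply.
have near_m : \forall m \near \oo, forall r, count_near b eta a m r = 1%N.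
  have /cvgrPdist_le/(_ _ u0) := aP.
  apply: filterS => m h.
  have h2 := close (fun x => x ^+ 2) 1 e m ler01 e0 (expr0n _ 2).
  have {}h2 : `|\sum_(k < m) a k ^+ 2 -
      \sum_(r < q) (count_near b eta a m r)%:R * b r ^+ 2| <= gam / 4.
    apply: le_trans (Hdl D Ddl); apply: h2 => x y _ _.
    by rewrite mul1r subr_sqr normrM ler_wpM2l// ler_normD.
  have cM r : (count_near b eta a m r < M.+1)%N.
    rewrite -(ltr_nat R); apply: le_lt_trans (truncnS_gt _).
    exact: (count_near_le eta0 eta_b (partial_sum_le aP)).
  have := gamE [ffun r => Ordinal (cM r)].
  case: ifPn => [/eqP d00 _ r|_]; last first.
    rewrite leNgt => /negP[]; rewrite /defect; under eq_bigr do rewrite ffunE/=.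
    set S := \sum_(k < m) _ in h h2; set X := \sum_(_ < _) _ in h2 *.
    by move: h h2; rewrite !ler_norml ltr_norml => /andP[? ?] /andP[? ?];
      apply/andP; split; lra.
  have := free (fun r => (count_near b eta a m r)%:R - 1).
  have -> : \sum_(i < q) ratr ((count_near b eta a m i)%:R - 1) * b i ^+ 2 = 0.
    rewrite -[RHS]d00 /defect -sumrB; apply: eq_bigr => s _.
    by rewrite ffunE/= rmorphB/= rmorph1 ratr_nat mulrBl mul1r.
  move=> /(_ erefl r)/eqP; rewrite subr_eq0 => /eqP c1.
  by apply/eqP; rewrite -(eqr_nat rat) c1.
have [m0 _ Hm0] := near_m.
by exists m0 => m mm0; exact: Hm0.
Qed.

End rigidity.

(** The transition matrices between [b] and the basis [e] are square: [L M = 1] since [e] is free,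
    hence [M L = 1]. A relation [c] on [b] gives [c M = 0] by freeness of [e], so
    [c = c M L = 0]. *)
Lemma rat_dim_free (R : realType) n (b : 'I_n -> R) :
  rat_dim (rat_span b) n -> rat_free b.
Proof.
move=> [e [free_e eE]].
have sb i : rat_span b (b i).
  exists (fun j => (j == i)%:R); rewrite (bigD1 i)//= eqxx rmorph1 mul1r.
  by rewrite big1 ?addr0// => j /negbTE ->; rewrite rmorph0 mul0r.
have se i : rat_span e (e i).
  exists (fun j => (j == i)%:R); rewrite (bigD1 i)//= eqxx rmorph1 mul1r.
  by rewrite big1 ?addr0// => j /negbTE ->; rewrite rmorph0 mul0r.
have /choice[M bM] i : rat_span e (b i) by rewrite -eE.
have /choice[L eL] i : rat_span b (e i) by rewrite eE.
pose MM := \matrix_(i, j) M i j : 'M[rat]_n.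
pose LL := \matrix_(i, j) L i j : 'M[rat]_n.
have expand (c : 'I_n -> rat) (K : 'I_n -> 'I_n -> rat) (x y : 'I_n -> R) :
    (forall i, x i = \sum_(j < n) ratr (K i j) * y j) ->
    \sum_(i < n) ratr (c i) * x i =
    \sum_(j < n) ratr (\sum_(i < n) c i * K i j) * y j.
  move=> xK; under eq_bigr do rewrite xK mulr_sumr.
  rewrite exchange_big/=; apply: eq_bigr => j _.
  rewrite rmorph_sum/= mulr_suml; apply: eq_bigr => i _.
  by rewrite rmorphM mulrA.
have LM1 : LL *m MM = 1%:M.
  apply/matrixP => i j; rewrite !mxE.
  under eq_bigr do rewrite !mxE.
  apply/eqP; rewrite -subr_eq0; apply/eqP.
  have := free_e (fun j => \sum_k L i k * M k j - (i == j)%:R).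
  apply; under eq_bigr do rewrite rmorphB mulrBl.
  rewrite sumrB -(expand (L i) M b e bM) -eL.
  rewrite (bigD1 i)//= eqxx rmorph1 mul1r big1 ?addr0 ?subrr// => k ki.
  by rewrite eq_sym (negbTE ki) rmorph0 mul0r.
have ML1 := mulmx1C LM1.
move=> c; rewrite (expand c M b e bM) => /free_e cM i.
have cM0 : (\row_k c k) *m MM = 0.
  by apply/rowP => j; rewrite !mxE -[RHS](cM j); apply: eq_bigr => k _; rewrite !mxE.
have : (\row_k c k) *m MM *m LL = 0 by rewrite cM0 mul0mx.
by rewrite -mulmxA ML1 mulmx1 => /rowP/(_ i); rewrite !mxE.
Qed.

(** * Wasserstein distance *)

Section wasserstein.
Context (R : realType).

Section upper.
Context d (T : measurableType d) (P : probability T R).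
Context d' (T' : measurableType d') (P' : probability T' R).

Lemma dW2_le (F : {RV P >-> R}) (G : {RV P' >-> R}) (Y : {RV P >-> R}) (M : R) :
  0 <= M -> same_law Y G ->
  (\int[P]_w ((F w - Y w) ^+ 2)%:E <= M%:E)%E -> (dW2 F G <= (Num.sqrt M)%:E)%E.
Proof.
move=> M0 YG FYM; rewrite /dW2 -[leRHS]/(sqrte M%:E) lee_sqrt ?lee_fin//.
apply: le_trans FYM; apply: ereal_inf_lbound.
by exists d, T, P, F, Y; split => //; rewrite unlock.
Qed.

Lemma dW2_lt (F : {RV P >-> R}) (G : {RV P' >-> R}) (e : R) : 0 < e ->
  (dW2 F G < e%:E)%E -> exists d0 (S : measurableType d0) (Q : probability S R)
    (X Y : {RV Q >-> R}), [/\ same_law X F, same_law Y G &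
      (\int[Q]_w ((X w - Y w) ^+ 2)%:E <= (e ^+ 2)%:E)%E].
Proof.
move=> e0; rewrite /dW2; set I := ereal_inf _ => Ie.
have I0 : (0 <= I)%E.
  apply/ereal_infP => _ [? [? [? [X [Y [_ _ ->]]]]]].
  by apply: expectation_ge0 => w; rewrite sqr_ge0.
have : (I < (e ^+ 2)%:E)%E.
  rewrite ltNge; apply/negP => h.
  move: Ie; rewrite ltNge => /negP; apply.
  have -> : e%:E = sqrte (e ^+ 2)%:E by rewrite /= sqrtr_sqr gtr0_norm.
  by rewrite lee_sqrt.
move=> /ereal_inf_lt[_ [d0 [S [Q [X [Y [XF YG ->]]]]]] lte].
by exists d0, S, Q, X, Y; split => //; move: lte; rewrite unlock => /ltW.
Qed.

End upper.

(** Chebyshev's inequality for a coupling: if [X <= x] but [Y > x + e], then [(X - Y)^2 >= e^2]. *)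
Lemma cdf_coupling d (T : measurableType d) (P : probability T R) (X Y : {RV P >-> R})
    (x e M : R) : 0 < e ->
  (\int[P]_w ((X w - Y w) ^+ 2)%:E <= M%:E)%E ->
  (cdf X x <= cdf Y (x + e)%R + (M / e ^+ 2)%:E)%E.
Proof.
move=> e0 XYM.
have cdfE (Z : {RV P >-> R}) z : cdf Z z = (\int[P]_w (\1_(Z @^-1` `]-oo, z]) w)%:E)%E.
  rewrite integral_indic ?setIT//.
  by rewrite -[X in measurable X]setTI; exact: measurable_funP.
rewrite !cdfE.
have e2 : 0 < e ^+ 2 by rewrite exprn_gt0.
have mI (Z : {RV P >-> R}) z : measurable_fun [set: T] (\1_(Z @^-1` `]-oo, z]) : T -> R).
  apply: measurable_indic.
  by rewrite -[X in measurable X]setTI; exact: measurable_funP.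
apply: (@le_trans _ _ (\int[P]_w (\1_(Y @^-1` `]-oo, (x + e)]) w)%:E +
   (e ^- 2)%:E * \int[P]_w ((X w - Y w) ^+ 2)%:E)%E).
  apply: ge0_integral_leD => //.
  - by rewrite invr_ge0 ltW.
  - by apply: measurable_funX; exact: measurable_funB.
  - by move=> w; rewrite sqr_ge0.
  have memE (Z : {RV P >-> R}) z w : (w \in Z @^-1` `]-oo, z]) = (Z w <= z).
    by apply/idP/idP; rewrite inE/= in_itv.
  move=> w; rewrite !indicE !memE.
  have h0 : 0 <= e ^- 2 * (X w - Y w) ^+ 2 by rewrite mulr_ge0 ?sqr_ge0// invr_ge0 ltW.
  have [Xx|_] := leP (X w) x; last by rewrite (le_trans h0)// lerDr.
  have [Yx|Yx] := leP (Y w) (x + e); first by rewrite lerDl.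
  rewrite add0r ler_pdivlMl// mulr1 -[(X w - Y w) ^+ 2]sqrrN opprB lerXn2r ?nnegrE//; lra.
rewrite leeD2l//; apply: le_trans (lee_wpmul2l _ XYM) _.
  by rewrite lee_fin invr_ge0 ltW.
by rewrite -EFinM lee_fin mulrC.
Qed.

(** Couplings of small cost squeeze the distribution function of [X n] at [x] between those of [Y]
    at [x - e'] and [x + e'], up to a small error; continuity at [x] closes the gap. *)
Lemma dW2_cvg_in_law d (T : measurableType d) (P : probability T R)
    (X : nat -> {RV P >-> R}) d' (T' : measurableType d') (P' : probability T' R)
    (Y : {RV P' >-> R}) :
  dW2 (X n) Y @[n --> \oo] --> 0%E -> converges_in_law X Y.
Proof.
move=> dW x Yx.
have finX n y : cdf (X n) y \is a fin_num by rewrite fin_num_measure.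
have finY y : cdf Y y \is a fin_num by rewrite fin_num_measure.
have {}Yx : fine (cdf Y y) @[y --> x] --> fine (cdf Y x).
  have : cdf Y y @[y --> x] --> (fine (cdf Y x))%:E by rewrite fineK.
  by move=> /fine_cvgP[].
rewrite -(fineK (finY x)); apply/fine_cvgP; split; first by apply: nearW.
apply/cvgrPdist_le => u u0.
have u2 : 0 < u / 2 by rewrite divr_gt0.
have /cvgrPdist_le/(_ _ u2)/nbhs_ballP[e /= e0 He] := Yx.
pose e' := e / 2.
have e'0 : 0 < e' by rewrite divr_gt0.
(* Since [eta <= 1], one has [eta^2 <= eta <= (u / 2) e'^2], so the Chebyshev term is at most
   [u / 2]. *)
pose eta := Num.min 1 (u / 2 * e' ^+ 2).
have eta0 : 0 < eta by rewrite lt_min ltr01 mulr_gt0// exprn_gt0.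
have eta2 : eta ^+ 2 / e' ^+ 2 <= u / 2.
  rewrite ler_pdivrMr ?exprn_gt0//; apply: (@le_trans _ _ eta).
    have eta1 : eta <= 1 by rewrite ge_min lexx.
    by rewrite expr2 ler_piMl// ltW.
  by rewrite ge_min lexx orbT.
have /fine_cvgP[finW /cvgrPdist_lt/(_ _ eta0) W0] := dW.
near=> n.
have fW : dW2 (X n) Y \is a fin_num by near: n.
have : (dW2 (X n) Y < eta%:E)%E.
  rewrite -(fineK fW) lte_fin; apply: le_lt_trans (ler_norm _) _.
  rewrite -normrN -[X in `|X|]sub0r; by near: n.
move=> /(dW2_lt eta0)[d0 [S [Q [X' [Y' [X'X Y'Y XY]]]]]].
have cX y : cdf X' y = cdf (X n) y by exact: X'X.
have cY y : cdf Y' y = cdf Y y by exact: Y'Y.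
have up : (cdf (X n) x <= cdf Y (x + e')%R + (eta ^+ 2 / e' ^+ 2)%:E)%E.
  by rewrite -cX -cY; exact: cdf_coupling.
have lo : (cdf Y (x - e')%R <= cdf (X n) x + (eta ^+ 2 / e' ^+ 2)%:E)%E.
  rewrite -cX -cY -[in leRHS](subrK e' x); apply: cdf_coupling => //.
  by under eq_integral do rewrite -sqrrN opprB.
have ballE y : `|x - y| < e -> `|fine (cdf Y x) - fine (cdf Y y)| <= u / 2.
  by move=> xy; apply: He; rewrite /ball/=.
have h1 := ballE (x + e'); have h2 := ballE (x - e').
move: up lo; rewrite -(fineK (finX n x)) -(fineK (finY (x + e'))) -(fineK (finY (x - e'))).
rewrite -!EFinD !lee_fin => up lo.
have {}h1 := h1 ltac:(rewrite opprD addNKr normrN gtr0_norm//; rewrite /e'; lra).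
have {}h2 := h2 ltac:(rewrite opprB addrC subrK gtr0_norm//; rewrite /e'; lra).
move: h1 h2; rewrite !ler_norml => /andP[? ?] /andP[? ?].
by apply/andP; split; lra.
Unshelve. all: by end_near. Qed.

End wasserstein.

Section pad.
Context (R : realType) (q : nat) (b : 'I_q -> R).

Lemma pad_ord (i : 'I_q) : pad b i = b i.
Proof. by rewrite /pad valK. Qed.

Lemma pad_ge k : (q <= k)%N -> pad b k = 0.
Proof. by move=> qk; rewrite /pad insubF// ltnNge qk. Qed.

Lemma sum_pad (f : R -> nat -> R) m : (q <= m)%N -> (forall k, f 0 k = 0) ->
  \sum_(k < m) f (pad b k) k = \sum_(i < q) f (b i) i.
Proof.
move=> qm f0; rewrite -(subnKC qm) big_split_ord/= [X in _ + X]big1 ?addr0.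
  by apply: eq_bigr => i _; rewrite pad_ord.
by move=> i _; rewrite pad_ge ?f0// leq_addr.
Qed.

Lemma Delta_pad : Delta b (pad b) = 0%E.
Proof.
rewrite /Delta eseries0// => k _ _; congr EFin.
have [kq|qk] := ltnP k q; last by rewrite pad_ge// expr0n mul0r.
rewrite (bigD1 (Ordinal kq))//= (pad_ord (Ordinal kq)) subrr expr0n/= mul0r mulr0.
by [].
Qed.

End pad.

(** * Couplings and the two distance bounds *)

Section main.
Context (R : realType) (q : nat) (b : 'I_q -> R).
Local Notation P2 := (\sum_(r < q) b r ^+ 2).
Local Notation v := (chi2_var R).

Section one_variable.
Context d (T : measurableType d) (P : probability T R).
Variables (N : nat -> {RV P >-> R}) (Finf F : {RV P >-> R}) (a : nat -> R).
Hypothesis iidN : iid_standard_normal N.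
Hypothesis FinfE : forall w, Finf w = \sum_(k < q) b k * (N k w ^+ 2 - 1).
Hypothesis Finf1 : (\int[P]_w (Finf w ^+ 2)%:E = 1)%E.
Hypothesis aF : chaos_expansion N a F.
Hypothesis F1 : (\int[P]_w (F w ^+ 2)%:E = 1)%E.

Lemma Finf_chi2_sum m w : (q <= m)%N -> Finf w = chi2_sum N id (pad b) m w.
Proof.
move=> qm; rewrite FinfE /chi2_sum.
by rewrite (sum_pad b (f := fun x k => x * (N k w ^+ 2 - 1)))// => k; rewrite mul0r.
Qed.

Lemma chi2_var_P2 : v * P2 = 1.
Proof.
have := integral_sqr_chi2_sum iidN (pad b) q.
rewrite (sum_pad b (f := fun x k => x ^+ 2))//; last by move=> _; rewrite expr0n.
under eq_integral do rewrite -Finf_chi2_sum//.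
by rewrite Finf1 => -[].
Qed.

Lemma chi2_var_gt0 : 0 < v.
Proof.
rewrite lt_neqAle chi2_var_ge0 andbT; apply/negP => /eqP v0.
by have /eqP := chi2_var_P2; rewrite -v0 mul0r eq_sym oner_eq0.
Qed.

Lemma coefficients_cvg : \sum_(k < m) a k ^+ 2 @[m --> \oo] --> P2.
Proof.
have v0 : v != 0 by rewrite gt_eqF// chi2_var_gt0.
have -> : P2 = v^-1 * 1 by rewrite -chi2_var_P2 mulKf.
have -> : (fun m => \sum_(k < m) a k ^+ 2) = (fun m => v^-1 * (v * \sum_(k < m) a k ^+ 2)).
  by apply/funext => m; rewrite mulKf.
apply: cvgM; first exact: cvg_cst.
exact: chaos_sum_sqr_cvg iidN aF F1.
Qed.

Lemma Finf_chaos : chaos_expansion N (pad b) Finf.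
Proof.
rewrite /chaos_expansion unlock; apply: cvg_near_cst.
exists q => // m /= qm; rewrite (eq_integral (cst 0%E)) ?integral_cst ?mul0e// => w _.
by rewrite (Finf_chi2_sum w qm) subrr expr0n.
Qed.

Lemma coefficients_le k : `|a k| <= 1 + P2.
Proof. exact: norm_le_sum_sqr (partial_sum_le coefficients_cvg) k. Qed.

Lemma power_sums_cvg j : (2 <= j)%N ->
  exists p : R, \sum_(k < m) a k ^+ j @[m --> \oo] --> p.
Proof.
move=> j2; apply/cvg_ex.
apply: (@dominated_series_cvg _ _ _ (partial_sum_le coefficients_cvg)
  (fun k => a k ^+ j) ((1 + P2) ^+ (j - 2))) => k.
have -> : a k ^+ j = a k ^+ (j - 2) * a k ^+ 2 by rewrite -exprD subnK.
rewrite normrM normrX (ger0_norm (sqr_ge0 _)) ler_wpM2r ?sqr_ge0//.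
have A0 : 0 <= 1 + P2 by exact: le_trans (normr_ge0 _) (coefficients_le k).
by rewrite lerXn2r ?nnegrE// coefficients_le.
Qed.

(** [F] and [Finf] live on the same space, so they form a coupling themselves, with
    [E (F - Finf)^2 <= 2 + 2]. *)
Lemma dW2_le2 : (dW2 F Finf <= 2%:E)%E.
Proof.
have -> : 2%:E = (Num.sqrt (4 : R))%:E.
  by congr EFin; rewrite -[4](_ : 2 ^+ 2 = _) ?sqrtr_sqr ?ger0_norm// -natrX.
apply: dW2_le => //.
have mFinf : measurable_fun [set: T] Finf by exact: measurable_funP.
have mF : measurable_fun [set: T] F by exact: measurable_funP.
have := integral_sqr_le P (@ltr01 R) (measurable_funB mF mFinf) mF.
have -> : (\int[P]_w ((((F : T -> R) \- Finf) w - F w) ^+ 2)%:E = 1)%E.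
  rewrite -Finf1; apply: eq_integral => w _; congr EFin; rewrite /=; ring.
by rewrite F1 invr1 !mule1 -EFinD => /le_trans; apply; rewrite lee_fin; lra.
Qed.

Lemma dW2_placed (tau : 'I_q -> nat) (E : R) : 0 <= E -> injective tau ->
  (forall m, \sum_(k < m) (a k - placed b tau k) ^+ 2 <= E) ->
  (dW2 F Finf <= (Num.sqrt (2 * v * E))%:E)%E.
Proof.
move=> E0 tau_inj aE.
(* The value [0] from [q] on is never read, because [Y] sums over [k < q] only. *)
pose tau' k := if insub k is Some i then tau i else 0%N.
have tau'E (i : 'I_q) : tau' i = tau i by rewrite /tau' valK.
have tau'_inj j k : (j < q)%N -> (k < q)%N -> tau' j = tau' k -> j = k.
  move=> jq kq; rewrite (tau'E (Ordinal jq)) (tau'E (Ordinal kq)).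
  by move=> /tau_inj[].
pose Y := chi2_sumRV N tau' (pad b) q.
have v0 := chi2_var_gt0.
apply: (@dW2_le _ _ _ _ _ _ _ _ _ Y).
- by rewrite mulr_ge0// mulr_ge0// ltW.
- move=> A mA; rewrite /distribution /pushforward.
  rewrite (distribution_chi2_sum iidN (pad b) tau'_inj mA); congr (P _).
  by apply/seteqP; split=> w /=; rewrite (Finf_chi2_sum w (leqnn q)).
have YE m w : (forall r, tau r < m)%N -> Y w = chi2_sum N id (placed b tau) m w.
  move=> taum; rewrite /Y/= /chi2_sum /placed.
  under [RHS]eq_bigr do rewrite mulr_suml.
  rewrite exchange_big/=; apply: eq_bigr => r _.
  rewrite (bigD1 (Ordinal (taum r)))//= eqxx mul1r big1 ?addr0 ?pad_ord ?tau'E// => k.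
  rewrite -val_eqE/= eq_sym => /negbTE ->.
  by rewrite !mul0r.
have [m0 Hm0] : exists m0, forall r, (tau r < m0)%N.
  exists (\max_r tau r).+1 => r; rewrite ltnS; exact: leq_bigmax.
apply/lee_addgt0Pr => e e0.
(* The comparison passes through a partial sum of [F]. [integral_sqr_le] with weight [1] doubles
   both the coefficient distance, whence the [2] in the conclusion, and the truncation error, whence
   [e / 2]. *)
have e2 : 0 < e / 2 by rewrite divr_gt0.
near \oo => m.
have [s /andP[s0 se] sE] : exists2 s, 0 <= s <= e / 2 &
    (\int[P]_w ((F w - chi2_sum N id a m w) ^+ 2)%:E = s%:E)%E.
  by near: m; exact: chaos_sqr_small aF _ e2.
have taum r : (tau r < m)%N.
  by apply: leq_trans (Hm0 r) _; near: m; exact: nbhs_infty_ge.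
have mF : measurable_fun [set: T] F by exact: measurable_funP.
have mY : measurable_fun [set: T] Y by exact: measurable_funP.
have mS := measurable_chi2_sum N id a m.
have := integral_sqr_le P (@ltr01 R) (measurable_funB mF mY) (measurable_funB mS mY).
have -> : (\int[P]_w ((((F : T -> R) \- Y) w - (chi2_sum N id a m \- Y) w) ^+ 2)%:E = s%:E)%E.
  by rewrite -sE; apply: eq_integral => w _; congr EFin; rewrite /=; ring.
have -> : (\int[P]_w ((chi2_sum N id a m \- Y) w ^+ 2)%:E =
    (v * \sum_(k < m) (a k - placed b tau k) ^+ 2)%:E)%E.
  rewrite -(integral_sqr_chi2_sum iidN (fun k => a k - placed b tau k)).
  apply: eq_integral => w _; congr (_ ^+ 2)%:E.
  transitivity (chi2_sum N id a m w - Y w) => //.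
  rewrite (YE m w taum) /chi2_sum -sumrB.
  by apply: eq_bigr => k _; rewrite mulrBl.
rewrite -!EFinM -!EFinD => /le_trans; apply; rewrite lee_fin invr1.
have : v * \sum_(k < m) (a k - placed b tau k) ^+ 2 <= v * E by rewrite ler_pM2l.
by lra.
Unshelve. all: by end_near. Qed.

End one_variable.

Lemma Delta_partial_sum (a : nat -> R) (D : R) : Delta b a = D%:E ->
  forall m, \sum_(k < m) Qpoly b (a k) <= D.
Proof.
move=> aD m; rewrite -lee_fin -aD -sumEFin.
rewrite -(big_mkord xpredT (fun k => (Qpoly b (a k))%:E)).
by apply: nneseries_lim_ge => k _ _; rewrite lee_fin Qpoly_ge0.
Qed.

Lemma Delta_ge0 (a : nat -> R) : (0 <= Delta b a)%E.
Proof. by apply: nneseries_ge0 => k _ _; rewrite lee_fin Qpoly_ge0. Qed.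

Lemma phin0_ge1 j : (2 <= j)%N -> 1 <= phin j (0 : R).
Proof.
move=> j2; rewrite phin0// -natrX -natrM ler1n muln_gt0 expn_gt0/=.
exact: fact_gt0.
Qed.

Hypotheses (b0 : forall r, b r != 0) (b_inj : injective b).

Lemma dW2_le_cumulants : exists2 C : R, 0 < C &
  forall d (T : measurableType d) (P : probability T R)
    (N : nat -> {RV P >-> R}) (Finf F : {RV P >-> R}) (a : nat -> R),
  iid_standard_normal N ->
  (forall w, Finf w = \sum_(k < q) b k * (N k w ^+ 2 - 1)) ->
  (\int[P]_w (Finf w ^+ 2)%:E = 1)%E -> chaos_expansion N a F ->
  (\int[P]_w (F w ^+ 2)%:E = 1)%E ->
  (dW2 F Finf <= C%:E * (sqrte (Delta b a) +
    (\sum_(2 <= r < q.+2) `|cumulant F r - cumulant Finf r|)%:E))%E.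
Proof.
have [C0 C00 [delta delta0 rigid]] := rigidity_cumulants b0 b_inj.
(* One summand per case: the coupling when [Delta] and the cumulant differences are at most [delta],
   and two multiples that lift the right-hand side above the trivial bound [2] when one of them
   exceeds [delta]. *)
pose C := Num.sqrt (2 * v * C0) + 2 / Num.sqrt delta + 2 / delta.
have sd0 : 0 < Num.sqrt delta by rewrite sqrtr_gt0.
have c1 : 0 <= Num.sqrt (2 * v * C0) by rewrite sqrtr_ge0.
have c2 : 0 < 2 / Num.sqrt delta by rewrite divr_gt0.
have c3 : 0 < 2 / delta by rewrite divr_gt0.
have Cgt0 : 0 < C by rewrite /C; lra.
have [C1 C2 C3] : [/\ Num.sqrt (2 * v * C0) <= C, 2 / Num.sqrt delta <= C &
    2 / delta <= C] by rewrite /C; split; lra.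
exists C => // d T P N Finf F a iidN FinfE Finf1 aF F1.
set K := \sum_(2 <= r < q.+2) _.
have K0 : 0 <= K by apply: sumr_ge0.
have := Delta_ge0 a; case DE : (Delta b a) => [D| |]//; last first.
  by move=> _; rewrite /= addye// gt0_muley ?lte_fin// leey.
rewrite lee_fin => D0; rewrite /= -EFinD -EFinM.
have aP := coefficients_cvg iidN FinfE Finf1 aF F1.
have aD := Delta_partial_sum DE.
have far : 2 <= C * (Num.sqrt D + K) ->
    (dW2 F Finf <= (C * (Num.sqrt D + K))%:E)%E.
  move=> h; apply: le_trans (dW2_le2 Finf1 F1) _; rewrite lee_fin//.
have sD0 := sqrtr_ge0 D.
have [Dd|Dd] := leP D delta; last first.
  apply: far; apply: (@le_trans _ _ (2 / Num.sqrt delta * Num.sqrt D)).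
    by rewrite -mulrA ler_peMr// ler_pdivlMl// mulr1 ler_wsqrtr// ltW.
  by apply: ler_pM; rewrite ?lerDl ?(ltW c2).
pose p j := lim (\sum_(k < m) a k ^+ j @[m --> \oo]).
have pP j : (2 <= j)%N -> \sum_(k < m) a k ^+ j @[m --> \oo] --> p j.
  by move=> /(power_sums_cvg iidN FinfE Finf1 aF F1)[l al]; exact: cvgP al.
have A0 : 0 < 1 + P2 by have := P2_ge0 b; lra.
have cumF j : (2 <= j)%N -> cumulant F j = phin j 0 * p j.
  move=> j2; apply: (cumulant_chaos iidN aF (partial_sum_le aP) A0 _ j2 (pP j j2)).
  exact: (coefficients_le iidN FinfE Finf1 aF F1).
have infchaos := Finf_chaos FinfE.
have infP := coefficients_cvg iidN FinfE Finf1 infchaos Finf1.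
have cumFinf j : (2 <= j)%N -> cumulant Finf j = phin j 0 * \sum_(r < q) b r ^+ j.
  move=> j2; apply: (cumulant_chaos iidN infchaos (partial_sum_le infP) A0 _ j2).
    exact: (coefficients_le iidN FinfE Finf1 infchaos Finf1).
  apply: cvg_near_cst; exists q => // m /= qm.
  by apply: (sum_pad b (f := fun x _ => x ^+ j)) => // _; rewrite expr0n gtn_eqF// ltnW.
have pK : \sum_(2 <= j < q.+2) `|p j - \sum_(r < q) b r ^+ j| <= K.
  rewrite /K big_nat [leRHS]big_nat; apply: ler_sum => j /andP[j2 _].
  (* The factor [phin j 0] is at least [1], so the power sums are at least as close as the
     cumulants. *)
  rewrite cumF// cumFinf// -mulrBr normrM ler_peMl//.
  by apply: le_trans (phin0_ge1 j2) (ler_norm _).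
have [Kd|Kd] := leP K delta; last first.
  apply: far; apply: (@le_trans _ _ (2 / delta * K)).
    by rewrite -mulrA ler_peMr// ler_pdivlMl// mulr1 ltW.
  by apply: ler_pM; rewrite ?lerDr ?(ltW c3).
have [tau tau_inj tauE] :=
  rigid a p D aP aD (fun j j2 => pP j (andP j2).1) Dd (le_trans pK Kd).
apply: le_trans (dW2_placed iidN FinfE Finf1 aF _ tau_inj tauE) _.
  by rewrite mulr_ge0// ltW.
rewrite lee_fin mulrA sqrtrM ?mulr_ge0 ?chi2_var_ge0 ?(ltW C00)//.
by apply: ler_pM; rewrite ?lerDl.
Qed.

Lemma dW2_le_Delta : rat_free (fun r => b r ^+ 2) -> exists2 C : R, 0 < C &
  forall d (T : measurableType d) (P : probability T R)
    (N : nat -> {RV P >-> R}) (Finf F : {RV P >-> R}) (a : nat -> R),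
  iid_standard_normal N ->
  (forall w, Finf w = \sum_(k < q) b k * (N k w ^+ 2 - 1)) ->
  (\int[P]_w (Finf w ^+ 2)%:E = 1)%E -> chaos_expansion N a F ->
  (\int[P]_w (F w ^+ 2)%:E = 1)%E ->
  (dW2 F Finf <= C%:E * sqrte (Delta b a))%E.
Proof.
move=> free; have [C0 C00 [delta delta0 rigid]] := rigidity_rat_free b0 b_inj free.
pose C := Num.sqrt (2 * v * C0) + 2 / Num.sqrt delta.
have sd0 : 0 < Num.sqrt delta by rewrite sqrtr_gt0.
have c1 : 0 <= Num.sqrt (2 * v * C0) by rewrite sqrtr_ge0.
have c2 : 0 < 2 / Num.sqrt delta by rewrite divr_gt0.
have Cgt0 : 0 < C by rewrite /C; lra.
exists C => // d T P N Finf F a iidN FinfE Finf1 aF F1.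
have := Delta_ge0 a; case DE : (Delta b a) => [D| |]//; last first.
  by move=> _; rewrite /= gt0_muley ?lte_fin// leey.
rewrite lee_fin => D0; rewrite /= -EFinM.
have aP := coefficients_cvg iidN FinfE Finf1 aF F1.
have sD0 := sqrtr_ge0 D.
have [Dd|Dd] := leP D delta; last first.
  apply: le_trans (dW2_le2 Finf1 F1) _; rewrite lee_fin.
  apply: (@le_trans _ _ (2 / Num.sqrt delta * Num.sqrt D)).
    by rewrite -mulrA ler_peMr// ler_pdivlMl// mulr1 ler_wsqrtr// ltW.
  by rewrite ler_wpM2r//; rewrite /C; lra.
have [tau tau_inj tauE] := rigid a D aP (Delta_partial_sum DE) Dd.
apply: le_trans (dW2_placed iidN FinfE Finf1 aF _ tau_inj tauE) _.
  by rewrite mulr_ge0// ltW.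
rewrite lee_fin mulrA sqrtrM ?mulr_ge0 ?chi2_var_ge0 ?(ltW C00)//.
by rewrite ler_wpM2r//; rewrite /C; lra.
Qed.

End main.

Unset Implicit Arguments.

Theorem corollary3p1 (R : realType) (q : nat) (q_ge2 : (2 <= q)%N)
    (ainf : 'I_q -> R) (ainf_neq0 : forall r, ainf r != 0)
    (ainf_inj : injective ainf) :
  exists C : R, 0 < C /\
  forall (d : measure_display) (T : measurableType d) (P : probability T R)
      (N : nat -> {RV P >-> R}) (Finf : {RV P >-> R})
      (a : nat -> nat -> R) (F : nat -> {RV P >-> R}),
    iid_standard_normal N ->
    (forall w, Finf w = \sum_(k < q) ainf k * (N k w ^+ 2 - 1)) ->
    'E_P[(fun w => (Finf w ^+ 2)%R)]%E = 1%E ->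
    (forall n, chaos_expansion N (a n) (F n)) ->
    (forall n, 'E_P[(fun w => (F n w ^+ 2)%R)]%E = 1%E) ->
    (forall n, (dW2 (F n) Finf <= C%:E * (sqrte (Delta ainf (a n)) +
       (\sum_(2 <= r < q.+2)
          `|cumulant (F n) r - cumulant Finf r|)%:E))%E) /\
    (rat_dim (rat_span (fun r => ainf r ^+ 2)) q ->
       (forall n, (dW2 (F n) Finf <= C%:E * sqrte (Delta ainf (a n)))%E) /\
       Delta ainf (pad ainf) = 0%E /\
       (Delta ainf (a n) @[n --> \oo] --> Delta ainf (pad ainf) ->
        converges_in_law F Finf)).
Proof.
have [C1 C10 HC1] := dW2_le_cumulants ainf_neq0 ainf_inj.
(* The constant is quantified before the rational hypothesis, so that hypothesis is decided
   classically here, with [1] as a placeholder when it fails; the sum [C1 + C2] serves both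
   bounds. *)
have [C2 C20 HC2] : exists2 C2 : R, 0 < C2 &
    rat_dim (rat_span (fun r => ainf r ^+ 2)) q ->
    forall d (T : measurableType d) (P : probability T R)
      (N : nat -> {RV P >-> R}) (Finf F : {RV P >-> R}) (a : nat -> R),
    iid_standard_normal N ->
    (forall w, Finf w = \sum_(k < q) ainf k * (N k w ^+ 2 - 1)) ->
    (\int[P]_w (Finf w ^+ 2)%:E = 1)%E -> chaos_expansion N a F ->
    (\int[P]_w (F w ^+ 2)%:E = 1)%E ->
    (dW2 F Finf <= C2%:E * sqrte (Delta ainf a))%E.
  have [/rat_dim_free free|nfree] :=
    pselect (rat_dim (rat_span (fun r => ainf r ^+ 2)) q); last by exists 1.
  by have [C2 C20 HC2] := dW2_le_Delta ainf_neq0 ainf_inj free; exists C2.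
exists (C1 + C2); split; first exact: addr_gt0.
move=> d T P N Finf a F iidN FinfE Finf1 aF F1.
have {}Finf1 : (\int[P]_w (Finf w ^+ 2)%:E = 1)%E by move: Finf1; rewrite unlock.
have {}F1 n : (\int[P]_w (F n w ^+ 2)%:E = 1)%E by have := F1 n; rewrite unlock.
split=> [n|free].
  apply: le_trans (HC1 _ _ _ _ _ _ _ iidN FinfE Finf1 (aF n) (F1 n)) _.
  apply: lee_wpmul2r; last by rewrite lee_fin lerDl ltW.
  by rewrite adde_ge0 ?sqrte_ge0// lee_fin sumr_ge0.
have bound n : (dW2 (F n) Finf <= (C1 + C2)%:E * sqrte (Delta ainf (a n)))%E.
  apply: le_trans (HC2 free _ _ _ _ _ _ _ iidN FinfE Finf1 (aF n) (F1 n)) _.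
  apply: lee_wpmul2r; first exact: sqrte_ge0.
  by rewrite lee_fin lerDr ltW.
split=> //; split; first exact: Delta_pad.
rewrite Delta_pad => Da; apply: dW2_cvg_in_law.
have /fine_cvgP[finD D0] := Da.
apply: (@squeeze_cvge _ _ _ _ (cst 0%E) _
  (fun n => ((C1 + C2) * Num.sqrt (fine (Delta ainf (a n))))%:E)).
- near=> n; rewrite sqrte_ge0/=; apply: le_trans (bound n) _.
  have fD : Delta ainf (a n) \is a fin_num by near: n.
  by rewrite -[in leLHS](fineK fD) /= -EFinM.
- exact: cvg_cst.
- apply: cvg_EFin; first exact: nearW.
  rewrite -(mulr0 (C1 + C2)); apply: cvgM; first exact: cvg_cst.
  rewrite -(@sqrtr0 R); apply: continuous_cvg => //.
  exact: sqrt_continuous.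
Unshelve. all: by end_near. Qed.
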